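(* Let $X$ be an effective Banach space that is not zero-dimensional. Then there exist bounded linear operators on $X$ that are not quasi-effective; in particular the operator $x\mapsto\sqrt{2}\,x$ (which is effective) is not quasi-effective.
   Context: $X$ is an effective Banach space (a Banach space with a Pour-El–Richards computability structure admitting a computable sequence $(e_n)$ with dense linear span), $X_k$ its set of computable elements; $(a_n)$ is a computable enumeration of the rational span $A$ of $(e_n)$. $\varphi_e$ is the $e$-th partial recursive function; $\varphi_{e,n}(m)\downarrow$ means the computation of $\varphi_e(m)$ halts within $n$ steps, $\uparrow$ that it does not. For $e,k\in\mathbb{N}$ the quasi-sequence $(\beta\langle e,k\rangle)_n$ is defined by cases: if $\varphi_{e,n}(0)\uparrow$ then $(\beta\langle e,k\rangle)_n=a_0$; otherwise $(\beta\langle e,k\rangle)_n=a_{\varphi_{e,n}(0)}$ if $\varphi_{e,n}(0)\downarrow$ and ($n$ is the least $n'$ with $\varphi_{e,n'}(0)\downarrow$, or $\varphi_{e,n}(1)\uparrow$); otherwise $(\beta\langle e,k\rangle)_n=a_{\varphi_{e,n}(m)}$ where $m$ is such that $\varphi_{e,n}(m)\downarrow$, $\|a_{\varphi_e(m)}-a_{\varphi_e(m-1)}\|<2^{-m}k$, and ($n$ is the least $n'$ with $\varphi_{e,n'}(m)\downarrow$, or $\varphi_{e,n}(m+1)\uparrow$, or $\|a_{\varphi_e(m+1)}-a_{\varphi_e(m)}\|>k\cdot2^{-(m+1)}$). Intended meaning: it follows $a_{\varphi_e(0)},a_{\varphi_e(1)},\dots$ while values are computed and consecutive differences obey the bound,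 and becomes constant otherwise. $\beta\langle e,k\rangle\in X_k$ is the limit of this sequence; $\beta$ is a total numbering of $X_k$. An operator $F$ on $X_k$ is quasi-effective if there is a partial recursive $\psi$ with $F(\beta i)=\beta\psi(i)$ for all $i$; it is effective if the analogous condition holds for the standard numbering $\alpha$ ($e\in\operatorname{dom}\alpha$ iff $\varphi_e$ total and $\|a_{\varphi_e(n)}-\lim_m a_{\varphi_e(m)}\|<2^{-n}$ for all $n$, $\alpha e=\lim_m a_{\varphi_e(m)}$).
   Formalization: That √2·x is not quasi-effective is proved only if a_0 ≠ 0 or √2·x leaves the rational span A for some x in A; otherwise it can fail, e.g. X = ℝ, e = (1, √2, 0, …), a_0 = 0. The existence claim is unconditional. *)

(* Defs.v *)
From Stdlib Require Cantor.
From HB Require Import structures.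
From mathcomp Require Import all_boot all_order all_algebra.
From mathcomp Require Import complex.
From mathcomp Require Import all_classical all_reals all_analysis.
Set Implicit Arguments.
Unset Strict Implicit.
Unset Printing Implicit Defensive.
Import Order.TTheory GRing.Theory Num.Theory.
Import numFieldNormedType.Exports.
Local Open Scope classical_set_scope.
Local Open Scope ring_scope.

Definition npair (x y : nat) : nat := Cantor.to_nat (x, y).
Definition nfst (i : nat) : nat := (Cantor.of_nat i).1.
Definition nsnd (i : nat) : nat := (Cantor.of_nat i).2.

(* [phi n e x] is phi_{e,n}(x): [Some y] if phi_e(x) halts with value y within
   n steps, [None] otherwise.  Indices are Goedel numbers of unary
   mu-recursive schemes on nat, several arguments being coded by [npair]:
     0, 1, 2, 3           zero, successor, first and second projection;
     4 + 4<f,g>           x |-> <f(x), g(x)>;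
     4 + 4<f,g> + 1       x |-> f(g(x));
     4 + 4<f,g> + 2       h<a,0> = f(a), h<a,m+1> = g<a,<m,h<a,m>>>;
     4 + 4f + 3           <a,m> |-> least m' >= m with f<a,m'> = 0.
   As usual the number of steps also bounds the arguments: if phi_{e,n}(x)
   halts then x < n. *)
Fixpoint phi (n e x : nat) {struct n} : option nat :=
  match n with
  | 0%N => None
  | n'.+1 =>
    if (n' < x)%N then None else
    match e with
    | 0%N => Some 0%N
    | 1%N => Some x.+1
    | 2%N => Some (nfst x)
    | 3%N => Some (nsnd x)
    | e'.+4 =>
      let c := (e' %/ 4)%N in
      let f := nfst c in
      let g := nsnd c in
      match (e' %% 4)%N with
      | 0%N => obind (fun u => omap (npair u) (phi n' g x)) (phi n' f x)
      | 1%N => obind (phi n' f) (phi n' g x)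
      | 2%N =>
        let a := nfst x in
        match nsnd x with
        | 0%N => phi n' f a
        | m.+1 => obind (fun u => phi n' g (npair a (npair m u)))
                        (phi n' e (npair a m))
        end
      | _ =>
        obind (fun u => if u == 0%N then Some (nsnd x)
                        else phi n' e (npair (nfst x) (nsnd x).+1))
              (phi n' c x)
      end
    end
  end.

Definition halts (n e x : nat) : bool := isSome (phi n e x).

(* phi_e(x) is defined and equal to y *)
Definition computes (e x y : nat) : Prop := exists n, phi n e x = Some y.

Definition recursive (f : nat -> nat) : Prop :=
  exists e, forall x, computes e x (f x).

Definition computable_rat_seq (r : nat -> rat) : Prop :=
  exists s p q : nat -> nat,
    [/\ recursive s, recursive p, recursive q &
        forall n, q n != 0%N /\ r n = (-1) ^+ s n * (p n)%:R / (q n)%:R].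

Definition computable_real_seq (R : realType) (x : nat -> R) : Prop :=
  exists r : nat -> rat, computable_rat_seq r /\
    forall n k, `|ratr (r (npair n k)) - x n| <= 2 ^- k.

(* Banach spaces are real or complex. *)
Variant scalars (R : realType) : numFieldType -> Type :=
  | RealScalars : scalars R R
  | ComplexScalars : scalars R R[i].

Definition of_real (R : realType) (K : numFieldType) (sc : scalars R K) :
    R -> K :=
  match sc in scalars _ K return R -> K with
  | RealScalars => fun x => x
  | ComplexScalars => fun x => x%:C%C
  end.

Definition rational_scalars (R : realType) (K : numFieldType)
    (sc : scalars R K) : set K :=
  match sc in scalars _ K return set K with
  | RealScalars => [set z | exists p : rat, z = ratr p]
  | ComplexScalars =>
      [set z | exists p q : rat, z = (ratr p +i* ratr q)%C]
  end.

Definition computable_scalar_seq (R : realType) (K : numFieldType)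
    (sc : scalars R K) : (nat -> K) -> Prop :=
  match sc in scalars _ K return (nat -> K) -> Prop with
  | RealScalars => fun z => computable_real_seq z
  | ComplexScalars => fun z =>
      computable_real_seq (fun n => complex.Re (z n)) /\
      computable_real_seq (fun n => complex.Im (z n))
  end.

Section EffectiveBanach.
Variables (R : realType) (K : numFieldType) (sc : scalars R K).
Variable X : completeNormedModType K.

(* The Pour-El--Richards axioms for the set S of computable sequences of X.
   Double sequences are computable when they are so after reindexing by the
   pairing function. *)
Record computability_structure (S : set (nat -> X)) : Prop := {
  linear_forms_axiom :
    forall (x y : nat -> X) (al be : nat -> nat -> K) (d : nat -> nat),
      S x -> S y ->
      computable_scalar_seq sc (fun i => al (nfst i) (nsnd i)) ->
      computable_scalar_seq sc (fun i => be (nfst i) (nsnd i)) ->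
      recursive d ->
      S (fun n => \sum_(k < (d n).+1) (al n k *: x k + be n k *: y k));
  limits_axiom :
    forall (x : nat -> nat -> X) (y : nat -> X) (md : nat -> nat),
      S (fun i => x (nfst i) (nsnd i)) ->
      recursive md ->
      (forall n N k, (md (npair n N) <= k)%N ->
         `|x n k - y n| <= 2 ^- N) ->
      S y;
  norms_axiom :
    forall x : nat -> X, S x -> computable_scalar_seq sc (fun n => `|x n|)
}.

Definition computable_elements (S : set (nat -> X)) : set X :=
  [set x | S (fun=> x)].

Definition linear_span (e : nat -> X) : set X :=
  [set x | exists N (c : nat -> K), x = \sum_(i < N) c i *: e i].

Definition rational_span (e : nat -> X) : set X :=
  [set x | exists N (c : nat -> K),
     (forall i, rational_scalars sc (c i)) /\ x = \sum_(i < N) c i *: e i].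

End EffectiveBanach.

Section Numberings.
Variables (K : numFieldType) (X : completeNormedModType K) (a : nat -> X).

(* a_{phi_{e,n}(m)}; only used when phi_{e,n}(m) halts *)
Definition approx (e n m : nat) : X := a (odflt 0%N (phi n e m)).

Definition close (e k n m : nat) : bool :=
  `|approx e n m - approx e n m.-1| < 2 ^- m * k%:R.

(* The position m is eligible at stage n if phi_e(0), ..., phi_e(m) have been
   computed, the consecutive differences up to m obey the bound, and either
   phi_e(m) has just been computed, or phi_e(m+1) has not been computed yet,
   or the next difference violates the bound. *)
Definition eligible (e k n m : nat) : bool :=
  [&& all (halts n e) (iota 0 m.+1),
      all (close e k n) (iota 1 m) &
      [|| [forall n' : 'I_n, ~~ halts n' e m],
          ~~ halts n e m.+1 |
          ~~ close e k n m.+1]].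

(* Some m < n is eligible as soon as phi_{e,n}(0) halts; [find] returns the
   least one. *)
Definition quasi_seq (e k n : nat) : X :=
  if halts n e 0 then approx e n (find (eligible e k n) (iota 0 n)) else a 0%N.

Definition beta (i : nat) : X := lim (quasi_seq (nfst i) (nsnd i) @ \oo).

(* e is in the domain of alpha, and alpha e = x *)
Definition alpha (e : nat) (x : X) : Prop :=
  exists f : nat -> nat,
    [/\ forall n, computes e n (f n),
        (fun m => a (f m)) @ \oo --> x &
        forall n, `|a (f n) - x| < 2 ^- n].

Definition quasi_effective (F : X -> X) : Prop :=
  exists p, forall i, exists j, computes p i j /\ F (beta i) = beta j.

Definition effective (F : X -> X) : Prop :=
  exists p, forall e x, alpha e x -> exists e', computes p e e' /\ alpha e' (F x).

End Numberings.

Definition bounded_linear (K : numFieldType) (X : normedModType K)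
    (F : X -> X) : Prop :=
  linear F /\ exists M : K, forall x, `|F x| <= M * `|x|.

(* Main.v *)
Require Import Defs.
From Stdlib Require Cantor.
From HB Require Import structures.
From mathcomp Require Import all_boot all_order all_algebra.
From mathcomp Require Import complex.
From mathcomp Require Import all_classical all_reals all_analysis.
From mathcomp Require Import zify ring lra.
Set Implicit Arguments.
Unset Strict Implicit.
Unset Printing Implicit Defensive.
Import Order.TTheory GRing.Theory Num.Theory.
Import numFieldNormedType.Exports.
Local Open Scope nat_scope.

(* Let p be an index of a candidate realizer of F on beta-indices.  A beta-index
   <c, k> can wait, by the recursion theorem, for information about its own
   image <c', k'> under p before it publishes its next value, while any finite
   part of the image sequence confines its limit to a ball of known radius.

   If F x lies outside A for some x in A, then the image of x cannot be
   the last value of a sequence that stops, so sooner or later it shows that its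
   limit is nonzero; at this moment <c, k> jumps from x to 0.  If
   a_0 <> 0, then the image of a_0 under x |-> sqrt 2 x must publish a
   first value, upon which <c, k> jumps from a_0 to a vector whose image is out
   of reach.  Diagonalizing against the computable sequence (a_n) gives a
   computable real c with c x outside A for a given x <> 0 in A, so that
   x |-> c x is never quasi-effective. *)

(** * Closure properties of recursive functions *)

(** A program that waits forever is still a [beta]-index: it denotes the value published last, or
    [a 0] if there is none. Under [alpha] such a program names nothing. This is why multiplication
    by the square root of 2 can be effective without being quasi-effective. The bound [k] is part of
    the index and has to be fixed before the program learns anything. So a jump either has a size
    known beforehand (from [a v] to 0), or it is made at position 0, which no bound constrains. The
    target 0 is convenient because [F 0 = 0] contradicts any evidence of a nonzero image. Neither
    jump settles the square root of 2 when [a 0 = 0] and A is stable under it, as for A = Q + Q sqrt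
    2 in the real line. Hence the disjunction in the last clause of the theorem, and the separately
    constructed scalar for the existence claim. Whatever is awaited must be semidecidable: halting
    facts, which require phi_{e,n}(x) to be recursive in all three arguments, and strict
    inequalities between computable reals. *)

Lemma nfst_npair x y : nfst (npair x y) = x.
Proof. by rewrite /nfst /npair Cantor.cancel_of_to. Qed.

Lemma nsnd_npair x y : nsnd (npair x y) = y.
Proof. by rewrite /nsnd /npair Cantor.cancel_of_to. Qed.

Lemma npairK z : npair (nfst z) (nsnd z) = z.
Proof.
rewrite /npair /nfst /nsnd -[RHS]Cantor.cancel_to_of.
by case: (Cantor.of_nat z).
Qed.

Lemma npair_double x y : npair x y * 2 = y * 2 + (y + x) * (y + x).+1.
Proof. by have := Cantor.to_nat_spec x y; rewrite /npair; lia. Qed.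

Lemma nfst_le z : nfst z <= z.
Proof. by have := npair_double (nfst z) (nsnd z); rewrite npairK; nia. Qed.

Lemma nsnd_le z : nsnd z <= z.
Proof. by have := npair_double (nfst z) (nsnd z); rewrite npairK; nia. Qed.

Definition npairE := (nfst_npair, nsnd_npair).

Definition ccode r c := (c * 4 + r).+4.
Definition pair_code f g := ccode 0 (npair f g).
Definition comp_code f g := ccode 1 (npair f g).
Definition rec_code f g := ccode 2 (npair f g).
Definition mu_code f := ccode 3 f.

(** The body of [phi] with its recursive calls made a parameter, so that one evaluation step can be
    analysed without unfolding the fixpoint. *)
Definition phi_step (F : nat -> nat -> option nat) n e x : option nat :=
  if n < x then None else
  match e with
  | 0 => Some 0
  | 1 => Some x.+1
  | 2 => Some (nfst x)
  | 3 => Some (nsnd x)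
  | e'.+4 =>
    let c := e' %/ 4 in
    let f := nfst c in
    let g := nsnd c in
    match e' %% 4 with
    | 0 => obind (fun u => omap (npair u) (F g x)) (F f x)
    | 1 => obind (F f) (F g x)
    | 2 =>
      let a := nfst x in
      match nsnd x with
      | 0 => F f a
      | m.+1 => obind (fun u => F g (npair a (npair m u))) (F e (npair a m))
      end
    | _ =>
      obind (fun u => if u == 0 then Some (nsnd x)
                      else F e (npair (nfst x) (nsnd x).+1)) (F c x)
    end
  end.

Lemma phiS n e x : phi n.+1 e x = phi_step (phi n) n e x.
Proof. by []. Qed.

Lemma phi_step_mono (F G : nat -> nat -> option nat) n n' e x y :
    (forall e x y, F e x = Some y -> G e x = Some y) -> n <= n' ->
  phi_step F n e x = Some y -> phi_step G n' e x = Some y.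
Proof.
move=> FG nn'; rewrite /phi_step; case: (ltnP n x) => // xn.
rewrite ltnNge (leq_trans xn nn') /=.
case: e => [|[|[|[|e]]]] //; case: (e %% 4) => [|[|[|_]]].
- case Ef: (F _ x) => [u|] //=; case Eg: (F _ x) => [v|] //=.
  by rewrite (FG _ _ _ Ef) /= (FG _ _ _ Eg).
- by case Eg: (F _ x) => [v|] //= /FG; rewrite (FG _ _ _ Eg).
- case: (nsnd x) => [|m]; first exact: FG.
  by case Eg: (F e.+4 _) => [v|] //= /FG; rewrite (FG _ _ _ Eg).
- case Eg: (F _ x) => [v|] //=; rewrite (FG _ _ _ Eg) /=.
  by case: ifP => // _; exact: FG.
Qed.

Lemma phi_mono n n' e x y : n <= n' -> phi n e x = Some y -> phi n' e x = Some y.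
Proof.
elim: n n' e x y => [//|n IH] [//|n'] e x y; rewrite ltnS => nn'.
by rewrite !phiS; apply: phi_step_mono => // {}e {}x {}y; exact: IH.
Qed.

Lemma phi_lt n e x y : phi n e x = Some y -> x < n.
Proof. by case: n => // n; rewrite phiS /phi_step; case: ltnP. Qed.

Lemma phi_None n e x : n <= x -> phi n e x = None.
Proof. by case E: (phi n e x) => [y|] //; have := phi_lt E; lia. Qed.

Lemma computes_fun e x y y' : computes e x y -> computes e x y' -> y = y'.
Proof.
move=> [n En] [n' En'].
have := phi_mono (leq_maxl n n') En; rewrite (phi_mono (leq_maxr n n') En').
by case.
Qed.

Lemma computes_step e x y :
  (exists n, phi_step (phi n) n e x = Some y) <-> computes e x y.
Proof.
split=> [[n E]|[[|n] E]] //; last by exists n.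
by exists n.+1.
Qed.

Lemma phi_step_ccode F n r c x : r < 4 -> x <= n ->
  phi_step F n (ccode r c) x =
    let f := nfst c in
    let g := nsnd c in
    match r with
    | 0 => obind (fun u => omap (npair u) (F g x)) (F f x)
    | 1 => obind (F f) (F g x)
    | 2 =>
      let a := nfst x in
      match nsnd x with
      | 0 => F f a
      | m.+1 => obind (fun u => F g (npair a (npair m u)))
                      (F (ccode r c) (npair a m))
      end
    | _ =>
      obind (fun u => if u == 0 then Some (nsnd x)
                      else F (ccode r c) (npair (nfst x) (nsnd x).+1)) (F c x)
    end.
Proof.
move=> r4 xn; rewrite /phi_step {1}/ccode ltnNge xn /=.
by rewrite modnMDl modn_small// divnMDl// divn_small// addn0.
Qed.

Lemma phi_step_le F n e x y : phi_step F n e x = Some y -> x <= n.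
Proof. by rewrite /phi_step; case: ltnP. Qed.

Lemma computes_zero x : computes 0 x 0.
Proof. by exists x.+1; rewrite phiS /phi_step ltnn. Qed.

Lemma computes_succ x : computes 1 x x.+1.
Proof. by exists x.+1; rewrite phiS /phi_step ltnn. Qed.

Lemma computes_nfst x : computes 2 x (nfst x).
Proof. by exists x.+1; rewrite phiS /phi_step ltnn. Qed.

Lemma computes_nsnd x : computes 3 x (nsnd x).
Proof. by exists x.+1; rewrite phiS /phi_step ltnn. Qed.

Lemma computes_pair f g x u v : computes f x u -> computes g x v ->
  computes (pair_code f g) x (npair u v).
Proof.
move=> [n En] [n' En']; apply/computes_step; exists (maxn x (maxn n n')).
rewrite phi_step_ccode ?leq_maxl//= !npairE.
by rewrite (phi_mono _ En) ?(phi_mono _ En')//; lia.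
Qed.

Lemma computes_comp f g x u y : computes g x u -> computes f u y ->
  computes (comp_code f g) x y.
Proof.
move=> [n En] [n' En']; apply/computes_step; exists (maxn x (maxn n n')).
rewrite phi_step_ccode ?leq_maxl//= !npairE.
by rewrite (phi_mono _ En) /= ?(phi_mono _ En')//; lia.
Qed.

Lemma computes_compE f g x y : computes (comp_code f g) x y ->
  exists2 u, computes g x u & computes f u y.
Proof.
move=> /computes_step[n E]; have xn := phi_step_le E.
move: E; rewrite phi_step_ccode//= !npairE.
by case Eg: (phi n g x) => [u|] //= Ef; exists u; exists n.
Qed.

Lemma computes_rec f g (h : nat -> nat -> nat) a :
    computes f a (h a 0) ->
    (forall m, computes g (npair a (npair m (h a m))) (h a m.+1)) ->
  forall m, computes (rec_code f g) (npair a m) (h a m).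
Proof.
move=> h0 hS; elim=> [|m [n En]]; apply/computes_step.
  have [n En] := h0; exists (maxn (npair a 0) n).
  by rewrite phi_step_ccode ?leq_maxl//= !npairE (phi_mono _ En)//; lia.
have [n' En'] := hS m; exists (maxn (npair a m.+1) (maxn n n')).
rewrite phi_step_ccode ?leq_maxl//= !npairE.
by rewrite (phi_mono _ En) /= ?(phi_mono _ En')//; lia.
Qed.

Lemma computes_mu f (h : nat -> nat) a m d :
    (forall x, computes f (npair a x) (h x)) ->
    (forall x, m <= x -> x < m + d -> h x != 0) -> h (m + d) = 0 ->
  computes (mu_code f) (npair a m) (m + d).
Proof.
move=> fh; elim: d m => [|d IH] m hn0 h0.
  apply/computes_step; have [n En] := fh m; exists (maxn (npair a m) n).
  rewrite phi_step_ccode ?leq_maxl//= !npairE.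
  rewrite (phi_mono _ En) /=; last by lia.
  by rewrite addn0 in h0 *; rewrite h0.
have [||n' En'] := IH m.+1; [by move=> x *; apply: hn0; lia|by rewrite addSnnS|].
apply/computes_step; have [n En] := fh m.
exists (maxn (npair a m) (maxn n n')).
rewrite phi_step_ccode ?leq_maxl//= !npairE.
rewrite (phi_mono _ En) /=; last by lia.
rewrite ifN ?hn0 //; [|by lia..].
by rewrite (phi_mono _ En') ?addSnnS//; lia.
Qed.

Lemma computes_muE f a m y : computes (mu_code f) (npair a m) y ->
  computes f (npair a y) 0.
Proof.
move=> [n]; elim: n m => [//|n IH] m; rewrite phiS => E.
have xn := phi_step_le E; move: E; rewrite phi_step_ccode//= !npairE.
case Ef: (phi n f _) => [u|] //=; case: eqP => [u0 [<-]|_]; last exact: IH.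
by exists n; rewrite Ef u0.
Qed.

Lemma recursive_ext f g : f =1 g -> recursive f -> recursive g.
Proof. by move=> fg [e he]; exists e => x; rewrite -fg. Qed.

Lemma recursive_comp f g : recursive f -> recursive g ->
  recursive (fun x => f (g x)).
Proof.
move=> [e he] [e' he']; exists (comp_code e e') => x.
exact: computes_comp (he' x) (he _).
Qed.

Lemma recursive_pair f g : recursive f -> recursive g ->
  recursive (fun x => npair (f x) (g x)).
Proof.
by move=> [e he] [e' he']; exists (pair_code e e') => x; apply: computes_pair.
Qed.

Lemma recursive_succ f : recursive f -> recursive (fun x => (f x).+1).
Proof. by apply: recursive_comp; exists 1; exact: computes_succ. Qed.

Lemma recursive_nfst f : recursive f -> recursive (fun x => nfst (f x)).
Proof. by apply: recursive_comp; exists 2; exact: computes_nfst. Qed.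

Lemma recursive_nsnd f : recursive f -> recursive (fun x => nsnd (f x)).
Proof. by apply: recursive_comp; exists 3; exact: computes_nsnd. Qed.

Lemma recursive_id : recursive (fun x => x).
Proof.
exists (pair_code 2 3) => x; rewrite -{2}[x]npairK.
exact: computes_pair (computes_nfst _) (computes_nsnd _).
Qed.

Lemma recursive_cst n : recursive (fun=> n).
Proof.
elim: n => [|n IH]; first by exists 0 => x; exact: computes_zero.
exact: recursive_succ.
Qed.

Definition recursive2 (op : nat -> nat -> nat) :=
  recursive (fun z => op (nfst z) (nsnd z)).

Lemma recursive2_comp op f g : recursive2 op -> recursive f -> recursive g ->
  recursive (fun x => op (f x) (g x)).
Proof.
move=> Hop Hf Hg; have := recursive_comp Hop (recursive_pair Hf Hg).
by apply: recursive_ext => x; rewrite !npairE.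
Qed.

Lemma recursive_primrec (h : nat -> nat -> nat) F G :
    recursive F -> recursive G -> (forall a, h a 0 = F a) ->
    (forall a m, h a m.+1 = G (npair a (npair m (h a m)))) ->
  recursive2 h.
Proof.
move=> [f hf] [g hg] h0 hS; exists (rec_code f g) => z.
rewrite -{1}[z]npairK; apply: computes_rec => [|m]; first by rewrite h0.
by rewrite hS.
Qed.

Ltac recur :=
  first [assumption | exact: recursive_id | exact: recursive_cst |
  lazymatch goal with
  | |- recursive (fun x => S (@?f x)) => apply: (@recursive_succ f); recur
  | |- recursive (fun x => nfst (@?f x)) => apply: (@recursive_nfst f); recur
  | |- recursive (fun x => nsnd (@?f x)) => apply: (@recursive_nsnd f); recur
  | |- recursive (fun x => npair (@?f x) (@?g x)) =>
      apply: (@recursive_pair f g); recur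
  | |- recursive (fun x => nat_of_bool (?op (@?f x) (@?g x))) =>
      apply: (@recursive2_comp (fun u v => nat_of_bool (op u v)) f g);
      [by auto with rec_db | recur | recur]
  | |- recursive (fun x => ?op (@?f x) (@?g x)) =>
      apply: (@recursive2_comp op f g);
      [by auto with rec_db | recur | recur]
  | |- recursive (fun x => ?op (@?f x)) =>
      apply: (@recursive_comp op f); [by auto with rec_db | recur]
  | _ => by auto with rec_db
  end].

Create HintDb rec_db.
#[global] Hint Extern 0 (recursive nfst) =>
  exact (recursive_nfst recursive_id) : rec_db.
#[global] Hint Extern 0 (recursive nsnd) =>
  exact (recursive_nsnd recursive_id) : rec_db.

Lemma recursive_addn : recursive2 addn.
Proof.
apply: (@recursive_primrec _ (fun x => x) (fun z => (nsnd (nsnd z)).+1));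
  [recur|recur|exact: addn0|].
by move=> a m; rewrite !npairE addnS.
Qed.
#[global] Hint Resolve recursive_addn : rec_db.

Lemma recursive_muln : recursive2 muln.
Proof.
apply: (@recursive_primrec _ (fun=> 0)
  (fun z => nsnd (nsnd z) + nfst z));
  [recur|recur|exact: muln0|].
by move=> a m; rewrite !npairE mulnS addnC.
Qed.
#[global] Hint Resolve recursive_muln : rec_db.

Lemma recursive_expn : recursive2 expn.
Proof.
apply: (@recursive_primrec _ (fun=> 1)
  (fun z => nsnd (nsnd z) * nfst z));
  [recur|recur|exact: expn0|].
by move=> a m; rewrite !npairE expnSr.
Qed.
#[global] Hint Resolve recursive_expn : rec_db.

Lemma recursive_predn : recursive predn.
Proof.
have : recursive2 (fun a m => m.-1).
  by apply: (@recursive_primrec _ (fun=> 0) (fun z => nfst (nsnd z)));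
    [recur|recur|by []|by move=> a m; rewrite !npairE].
move=> H; have := recursive2_comp H recursive_id recursive_id; exact.
Qed.
#[global] Hint Resolve recursive_predn : rec_db.

Lemma recursive_subn : recursive2 subn.
Proof.
apply: (@recursive_primrec _ (fun x => x) (fun z => (nsnd (nsnd z)).-1));
  [recur|recur|exact: subn0|].
by move=> a m; rewrite !npairE subnS.
Qed.
#[global] Hint Resolve recursive_subn : rec_db.

Lemma recursive_eq0 f : recursive f -> recursive (fun x => (f x == 0) : nat).
Proof.
move=> hf; have : recursive (fun x => 1 - f x) by recur.
by apply: recursive_ext => x; case: (f x).
Qed.

Lemma recursive_leq : recursive2 (fun x y => x <= y).
Proof. by apply: (@recursive_eq0 (fun z => nfst z - nsnd z)); recur. Qed.
#[global] Hint Resolve recursive_leq : rec_db.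

Lemma recursive_if (b : nat -> bool) f g : recursive (fun x => (b x : nat)) ->
    recursive f -> recursive g ->
  recursive (fun x => if b x then f x else g x).
Proof.
move=> hb hf hg.
have : recursive (fun x => (b x : nat) * f x + (1 - b x) * g x).
  by recur.
by apply: recursive_ext => x; case: (b x) => /=; lia.
Qed.

Lemma recursive_eqn : recursive2 (fun x y => x == y).
Proof.
have : recursive (fun z => (nfst z - nsnd z + (nsnd z - nfst z) == 0) : nat).
  by apply: (@recursive_eq0 (fun z => nfst z - nsnd z + (nsnd z - nfst z))); recur.
by apply: recursive_ext => z; congr nat_of_bool; lia.
Qed.
#[global] Hint Resolve recursive_eqn : rec_db.

Lemma recursive_andb (b c : nat -> bool) :
    recursive (fun x => (b x : nat)) -> recursive (fun x => (c x : nat)) ->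
  recursive (fun x => (b x && c x : nat)).
Proof.
move=> hb hc; have : recursive (fun x => (b x : nat) * (c x : nat)) by recur.
by apply: recursive_ext => x; case: (b x); case: (c x).
Qed.

Ltac recur_if :=
  lazymatch goal with
  | |- recursive (fun x => nat_of_bool (@?b x && @?c x)) =>
      apply: (@recursive_andb b c); recur_if
  | _ => first [recur | apply: recursive_if; recur_if]
  end.

Lemma mu_index g : recursive g ->
  exists q, forall x, (forall y, computes q x y -> g (npair x y) = 0) /\
    ((exists y, g (npair x y) = 0) -> exists y, computes q x y).
Proof.
move=> [c hc]; have [i hi] := recursive_id.
have hz x : computes (pair_code i 0) x (npair x 0).
  exact: computes_pair (hi x) (computes_zero x).
exists (comp_code (mu_code c) (pair_code i 0)) => x; split=> [y|].
  case/computes_compE => u /(computes_fun (hz x)) <- /computes_muE hy.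
  exact: computes_fun (hc _) hy.
move=> exy; have exy' : exists y, g (npair x y) == 0.
  by have [y /eqP] := exy; exists y.
case: (ex_minnP exy') => y /eqP y0 ymin; exists y.
apply: computes_comp (hz x) _; rewrite -[y]add0n.
apply: (computes_mu (h := fun t => g (npair x t))) => [t//|t _ ty|//].
by apply/negP => /ymin; lia.
Qed.

(** Uniqueness of the solution identifies whatever the search returns with [f x]. Division and the
    integer square root are obtained in this way from their decidable graphs. *)
Lemma recursive_search (b : nat -> nat -> bool) f :
    recursive2 (fun x y => b x y) -> (forall x, b x (f x)) ->
    (forall x y, b x y -> y = f x) -> recursive f.
Proof.
move=> hb bf bU.
have [|q hq] := @mu_index (fun z => 1 - b (nfst z) (nsnd z)).
  by apply: (@recursive2_comp subn); [recur|recur|exact: hb].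
exists q => x; have [hq1 [|y hy]] := hq x.
  by exists (f x); rewrite !npairE bf.
have := hq1 _ hy; rewrite !npairE; case E: (b x y) => // _.
by rewrite -(bU _ _ E).
Qed.

Lemma recursive_divn : recursive2 divn.
Proof.
pose b z y := let m := nfst z in let d := nsnd z in
  if d == 0 then y == 0 else (y * d <= m) && (m < y.+1 * d).
apply: (recursive_search (b := b)).
- have : recursive (fun z => if nsnd (nfst z) == 0 then (nsnd z == 0 : nat) else
    ((nsnd z * nsnd (nfst z) <= nfst (nfst z)) &&
     (nfst (nfst z) < (nsnd z).+1 * nsnd (nfst z)) : nat)) by recur_if.
  by apply: recursive_ext => z; rewrite /b; case: ifP.
- move=> z; rewrite /b; case: ifP => [/eqP->//|/negbT d0].
  by rewrite leq_divM ltn_ceil// lt0n.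
- move=> z y; rewrite /b; case: ifP => [/eqP-> /eqP->//|/negbT d0 /andP[h1 h2]].
  move: d0 (leq_divM (nfst z) (nsnd z)); rewrite -lt0n => d0.
  by have := ltn_ceil (nfst z) d0; nia.
Qed.
#[global] Hint Resolve recursive_divn : rec_db.

Lemma recursive_modn : recursive2 modn.
Proof.
have : recursive (fun z => nfst z - nfst z %/ nsnd z * nsnd z) by recur.
by apply: recursive_ext => z; rewrite {1}(divn_eq (nfst z) (nsnd z)) addKn.
Qed.
#[global] Hint Resolve recursive_modn : rec_db.

(** * The universal function *)

(** Finite lists are coded as iterated pairs without a stored length: [l] second projections lead to
    the tail that starts with entry [l]. *)
Definition lookup T l := nfst (iter l nsnd T).

Lemma recursive_lookup : recursive2 lookup.
Proof.
have : recursive2 (fun T l => iter l nsnd T).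
  by apply: (@recursive_primrec _ (fun x => x) (fun z => nsnd (nsnd (nsnd z))));
    [recur|recur|by []|move=> a m; rewrite !npairE].
exact: recursive_nfst.
Qed.
#[global] Hint Resolve recursive_lookup : rec_db.

Lemma lookup0 h T : lookup (npair h T) 0 = h.
Proof. by rewrite /lookup npairE. Qed.

Lemma lookupS h T l : lookup (npair h T) l.+1 = lookup T l.
Proof. by rewrite /lookup iterSr npairE. Qed.

Lemma lookup_ex m (t : nat -> nat) : exists T, forall l, l < m -> lookup T l = t l.
Proof.
elim: m t => [|m IH] t; first by exists 0.
have [T hT] := IH (fun l => t l.+1); exists (npair (t 0) T) => -[_|l lm].
  exact: lookup0.
by rewrite lookupS hT.
Qed.

Fixpoint table (G : nat -> nat) p L :=
  if L is L'.+1 then npair (G (npair p L')) (table G p L') else 0.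

Lemma lookup_table G p L l : l < L ->
  lookup (table G p L) (L - l.+1) = G (npair p l).
Proof.
elim: L => // L IH; rewrite ltnS leq_eqVlt => /predU1P[->|lL] /=.
  by rewrite subnn lookup0.
by rewrite (_ : L.+1 - l.+1 = (L - l.+1).+1) ?lookupS ?IH//; lia.
Qed.

Lemma recursive_table G : recursive G -> recursive2 (table G).
Proof.
move=> hG; apply: (@recursive_primrec _ (fun=> 0)
  (fun z => npair (G (npair (nfst z) (nfst (nsnd z)))) (nsnd (nsnd z))));
  [recur|recur|by []|by move=> a m; rewrite !npairE].
Qed.

Definition oenc (o : option nat) := if o is Some y then y.+1 else 0.

(* [r] is the table of the values [oenc (phi n f y)] at position [npair f y],
   filled from the end. *)
Definition table_phi L n r f y :=
  if y < n then lookup r (L - (npair f y).+1) else 0.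

Definition sub_fst e := nfst ((e - 4) %/ 4).
Definition sub_snd e := nsnd ((e - 4) %/ 4).

Definition table_step_comp L n r e x :=
  if (e - 4) %% 4 == 0 then
    if table_phi L n r (sub_fst e) x == 0 then 0 else
    if table_phi L n r (sub_snd e) x == 0 then 0 else
      (npair (table_phi L n r (sub_fst e) x).-1
             (table_phi L n r (sub_snd e) x).-1).+1
  else
    if table_phi L n r (sub_snd e) x == 0 then 0 else
      table_phi L n r (sub_fst e) (table_phi L n r (sub_snd e) x).-1.

Definition table_step_rec L n r e x :=
  if (e - 4) %% 4 == 2 then
    if nsnd x == 0 then table_phi L n r (sub_fst e) (nfst x) else
    if table_phi L n r e (npair (nfst x) (nsnd x).-1) == 0 then 0 else
    table_phi L n r (sub_snd e) (npair (nfst x) (npair (nsnd x).-1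
      (table_phi L n r e (npair (nfst x) (nsnd x).-1)).-1))
  else
    if table_phi L n r ((e - 4) %/ 4) x == 0 then 0 else
    if table_phi L n r ((e - 4) %/ 4) x == 1 then (nsnd x).+1 else
    table_phi L n r e (npair (nfst x) (nsnd x).+1).

Definition table_step L n r e x :=
  if n < x then 0 else
  if e == 0 then 1 else if e == 1 then x.+2 else
  if e == 2 then (nfst x).+1 else if e == 3 then (nsnd x).+1 else
  if (e - 4) %% 4 <= 1 then table_step_comp L n r e x
  else table_step_rec L n r e x.

Section TableRecursive.
Variables L n r : nat -> nat.
Hypotheses (hL : recursive L) (hn : recursive n) (hr : recursive r).

Lemma recursive_table_phi f y : recursive f -> recursive y ->
  recursive (fun z => table_phi (L z) (n z) (r z) (f z) (y z)).
Proof. by move=> hf hy; rewrite /table_phi; recur_if. Qed.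

Lemma recursive_sub_fst : recursive sub_fst.
Proof. by rewrite /sub_fst; recur. Qed.

Lemma recursive_sub_snd : recursive sub_snd.
Proof. by rewrite /sub_snd; recur. Qed.
Hint Resolve recursive_sub_fst recursive_sub_snd : rec_db.

Ltac recur_table :=
  first [assumption |
  lazymatch goal with
  | |- recursive (fun x => nat_of_bool (eq_op (@?b x) (@?c x))) =>
      apply: (@recursive2_comp (fun u v => nat_of_bool (u == v)) b c);
      [by auto with rec_db|recur_table|recur_table]
  | |- recursive (fun x => npair (@?f x) (@?g x)) =>
      apply: (@recursive_pair f g); recur_table
  | |- recursive (fun x => S (@?f x)) =>
      apply: (@recursive_succ f); recur_table
  | |- recursive (fun x => predn (@?f x)) =>
      apply: (@recursive_comp predn f); [by auto with rec_db|recur_table]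
  | |- recursive (fun x => table_phi _ _ _ (@?f x) (@?g x)) =>
      apply: (@recursive_table_phi f g); recur_table
  | _ => first [recur | apply: recursive_if; recur_table]
  end].

Lemma recursive_table_step e x : recursive e -> recursive x ->
  recursive (fun z => table_step (L z) (n z) (r z) (e z) (x z)).
Proof.
move=> he hx; rewrite /table_step /table_step_comp /table_step_rec.
by recur_table.
Qed.

End TableRecursive.

Lemma table_stepE L n r e x :
    (forall f y, f <= e -> table_phi L n r f y = oenc (phi n f y)) ->
  table_step L n r e x = oenc (phi n.+1 e x).
Proof.
move=> hr; rewrite phiS /table_step /phi_step; case: ltnP => // xn.
case: e hr => [|[|[|[|e]]]] // hr.
have hc : e %/ 4 <= e.+4 by have := leq_divM e 4; lia.
have hf : nfst (e %/ 4) <= e.+4 by have := nfst_le (e %/ 4); lia.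
have hg : nsnd (e %/ 4) <= e.+4 by have := nsnd_le (e %/ 4); lia.
rewrite /= /table_step_comp /table_step_rec /sub_fst /sub_snd.
rewrite (_ : e.+4 - 4 = e); last by lia.
have : e %% 4 < 4 by rewrite ltn_mod.
case: (e %% 4) => [|[|[|[|//]]]] _ /=; rewrite ?hr//.
- case: (phi n (nfst _) x) => [u|] //=; case: (phi n (nsnd _) x) => [v|] //=.
- by case: (phi n (nsnd _) x) => [v|] //=; rewrite ?hr.
- case: (nsnd x) => [|m] //=.
  by rewrite ?hr//; case: (phi n e.+4 _) => [v|] //=; rewrite ?hr.
- by case: (phi n _ x) => [[|v]|] //=; rewrite ?hr.
Qed.

Definition table_cell z :=
  table_step (nfst (nfst z)) (nfst (nsnd (nfst z))) (nsnd (nsnd (nfst z)))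
             (nfst (nsnd z)) (nsnd (nsnd z)).

Fixpoint phi_table L n :=
  if n is n'.+1 then table table_cell (npair L (npair n' (phi_table L n'))) L
  else 0.

Lemma recursive_phi_table : recursive2 phi_table.
Proof.
have h : recursive2 (table table_cell).
  by apply: recursive_table; apply: recursive_table_step; recur.
apply: (@recursive_primrec _ (fun=> 0) (fun z => table table_cell z (nfst z)));
  [recur|recur|by []|by move=> a m /=; rewrite npairE].
Qed.
#[global] Hint Resolve recursive_phi_table : rec_db.

(** A finite table suffices for each stage: evaluating [e] calls only indices at most [e], and at
    stage [n] every argument from [n] on diverges by the step convention, without any lookup. The
    size is chosen to exceed every [npair f y] with [f <= E] and [y < N]. The universal function
    thus becomes primitive recursion on the stage. *)
Lemma phi_tableE E N n e x : e <= E -> n <= N ->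
  table_phi ((E + N).+2 * (E + N).+2) n (phi_table ((E + N).+2 * (E + N).+2) n) e x
  = oenc (phi n e x).
Proof.
set L := _ * _ => eE; elim: n e x eE => [//|n IH] e x eE nN.
rewrite /table_phi; case: ltnP => xn; last by rewrite phi_None.
rewrite lookup_table.
  by rewrite /table_cell !npairE; apply: table_stepE => f y fe; apply: IH; lia.
have := npair_double e x; rewrite /L; nia.
Qed.

Lemma recursive_oenc_phi n e x : recursive n -> recursive e -> recursive x ->
  recursive (fun z => oenc (phi (n z) (e z) (x z))).
Proof.
move=> hn he hx.
have : recursive (fun z =>
   let L := (e z + n z).+2 * (e z + n z).+2 in
   table_phi L (n z) (phi_table L (n z)) (e z) (x z)).
  by apply: recursive_table_phi => //; recur.
by apply: recursive_ext => z; exact: phi_tableE.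
Qed.

(** * Semidecidable sets and the recursion theorem *)

Definition sigma1 (P : nat -> Prop) :=
  exists2 g, recursive g & forall x, P x <-> exists t, g (npair x t) = 0.

Lemma sigma1_ext P Q : (forall x, P x <-> Q x) -> sigma1 P -> sigma1 Q.
Proof. by move=> PQ [g hg gP]; exists g => // x; rewrite -PQ. Qed.

Lemma sigma1_comp P f : sigma1 P -> recursive f -> sigma1 (fun x => P (f x)).
Proof.
move=> [g hg gP] hf; exists (fun z => g (npair (f (nfst z)) (nsnd z))).
  by recur.
move=> x; rewrite gP.
by split=> -[t ht]; exists t; move: ht; rewrite !npairE.
Qed.

Lemma sigma1_dec (b : nat -> bool) : recursive (fun x => (b x : nat)) ->
  sigma1 (fun x => b x).
Proof.
move=> hb; exists (fun z => 1 - b (nfst z)).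
  have h := recursive_comp hb (recursive_nfst recursive_id).
  by apply: (recursive2_comp recursive_subn); [recur|exact: h].
move=> x; split=> [bx|[t]]; first by exists 0; rewrite npairE bx.
by rewrite npairE; case: (b x).
Qed.

Lemma sigma1_and P Q : sigma1 P -> sigma1 Q -> sigma1 (fun x => P x /\ Q x).
Proof.
move=> [g hg gP] [h hh hQ].
exists (fun z => g (npair (nfst z) (nfst (nsnd z))) +
                 h (npair (nfst z) (nsnd (nsnd z)))); first by recur.
move=> x; rewrite gP hQ; split=> [[[t gt] [s hs]]|[t]].
  by exists (npair t s); rewrite !npairE gt hs.
by rewrite !npairE => ts; split; [exists (nfst t)|exists (nsnd t)]; lia.
Qed.

Lemma sigma1_or P Q : sigma1 P -> sigma1 Q -> sigma1 (fun x => P x \/ Q x).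
Proof.
move=> [g hg gP] [h hh hQ].
exists (fun z => g z * h z); first by recur.
move=> x; rewrite gP hQ; split=> [[[t gt]|[t ht]]|[t]].
- by exists t; rewrite gt.
- by exists t; rewrite ht muln0.
- by move/eqP; rewrite muln_eq0 => /orP[]/eqP ht; [left|right]; exists t.
Qed.

Lemma sigma1_ex (P : nat -> nat -> Prop) :
  sigma1 (fun z => P (nfst z) (nsnd z)) -> sigma1 (fun x => exists y, P x y).
Proof.
move=> [g hg gP]; exists (fun z => g (npair (npair (nfst z) (nfst (nsnd z)))
  (nsnd (nsnd z)))); first by recur.
move=> x; split=> [[y Pxy]|[t]].
  have /gP[t ht] : P (nfst (npair x y)) (nsnd (npair x y)) by rewrite !npairE.
  by exists (npair y t); rewrite !npairE.
rewrite !npairE => gt; exists (nfst t).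
have := (gP (npair x (nfst t))).2 (ex_intro _ _ gt); by rewrite !npairE.
Qed.

(** The witnesses for all [l < m x] are packed into one coded list, and a sum of naturals vanishes
    exactly when each term does, so a single existential quantifier remains. *)
Lemma sigma1_bforall (m : nat -> nat) (P : nat -> nat -> Prop) : recursive m ->
  sigma1 (fun z => P (nfst z) (nsnd z)) ->
  sigma1 (fun x => forall l, l < m x -> P x l).
Proof.
move=> hm [g hg gP].
pose s z k := \sum_(l < k) g (npair (npair (nfst z) l) (lookup (nsnd z) l)).
have hs : recursive2 s.
  apply: (@recursive_primrec _ (fun=> 0) (fun z => nsnd (nsnd z) +
    g (npair (npair (nfst (nfst z)) (nfst (nsnd z)))
             (lookup (nsnd (nfst z)) (nfst (nsnd z)))))); [recur|recur| |].
    by move=> a; rewrite /s big_ord0.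
  by move=> a k; rewrite /s big_ord_recr /= !npairE.
exists (fun z => s z (m (nfst z))).
  by apply: (recursive2_comp hs); recur.
move=> x; split=> [Px|[T]].
  have /choice[t ht] : forall l, exists t, l < m x -> g (npair (npair x l) t) = 0.
    move=> l; case: (ltnP l (m x)) => [lm|]; last by exists 0.
    have /gP[t ht] : P (nfst (npair x l)) (nsnd (npair x l)).
      by rewrite !npairE; exact: Px.
    by exists t.
  have [T hT] := lookup_ex (m x) t; exists T.
  rewrite /s !npairE big1// => l _; rewrite hT//; exact: ht.
rewrite /s !npairE => /eqP; rewrite sum_nat_eq0 => /forallP sl l lm.
have /eqP /= gl := sl (Ordinal lm).
have := (gP (npair x l)).2 (ex_intro _ _ gl); by rewrite !npairE.
Qed.

Lemma sigma1_computes e x y : recursive e -> recursive x -> recursive y ->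
  sigma1 (fun z => computes (e z) (x z) (y z)).
Proof.
move=> he hx hy.
have : sigma1 (fun z => exists n, oenc (phi n (e z) (x z)) == (y z).+1).
  apply: sigma1_ex; apply: sigma1_dec.
  apply: (@recursive2_comp (fun u v => nat_of_bool (u == v))).
  - by auto with rec_db.
  - by apply: recursive_oenc_phi; recur.
  - by recur.
apply: sigma1_ext => z; split=> -[n hn]; exists n.
  by case: (phi _ _ _) hn => //= u /eqP[->].
by rewrite hn /=.
Qed.

(** The search runs over pairs of a candidate [y] and a witness for it, and then projects (code 2)
    to [y]. It selects some solution, not the least one. *)
Lemma sigma1_index (P : nat -> nat -> Prop) :
    sigma1 (fun z => P (nfst z) (nsnd z)) ->
  exists q, forall x, (forall y, computes q x y -> P x y) /\
    ((exists y, P x y) -> exists y, computes q x y).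
Proof.
move=> [g hg gP].
have [|q hq] := @mu_index (fun z => g (npair (npair (nfst z) (nfst (nsnd z)))
  (nsnd (nsnd z)))); first by recur.
exists (comp_code 2 q) => x; have [hq1 hq2] := hq x; split=> [y|[y Pxy]].
  case/computes_compE => u /hq1; rewrite !npairE => gu.
  move/(computes_fun (computes_nfst u)) => <-.
  by have := (gP (npair x (nfst u))).2 (ex_intro _ _ gu); rewrite !npairE.
have /gP[t ht] : P (nfst (npair x y)) (nsnd (npair x y)) by rewrite !npairE.
have [|u hu] := hq2; first by exists (npair y t); rewrite !npairE.
by exists (nfst u); apply: computes_comp hu (computes_nfst u).
Qed.

Lemma sigma1_choice (P : nat -> nat -> Prop) :
    sigma1 (fun z => P (nfst z) (nsnd z)) -> (forall x, exists y, P x y) ->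
  exists2 f, recursive f & forall x, P x (f x).
Proof.
move=> /sigma1_index[q hq] Pex.
have /choice[f hf] : forall x, exists y, computes q x y.
  by move=> x; apply: (hq x).2.
by exists f; [exists q|move=> x; apply: (hq x).1].
Qed.

Fixpoint cst_code v := if v is v'.+1 then comp_code 1 (cst_code v') else 0.

Lemma computes_cst v x : computes (cst_code v) x v.
Proof.
elim: v => [|v IH]; first exact: computes_zero.
exact: computes_comp IH (computes_succ v).
Qed.

Lemma recursive_ccode r c : recursive c -> recursive (fun x => ccode r (c x)).
Proof. by move=> hc; rewrite /ccode; recur. Qed.

Lemma recursive_pair_code : recursive2 pair_code.
Proof. by apply: recursive_ccode; recur. Qed.

Lemma recursive_comp_code : recursive2 comp_code.
Proof. by apply: recursive_ccode; recur. Qed.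
#[global] Hint Resolve recursive_pair_code recursive_comp_code : rec_db.

Lemma recursive_cst_code : recursive cst_code.
Proof.
have H : recursive2 (fun=> cst_code).
  apply: (@recursive_primrec _ (fun=> 0) (fun z => comp_code 1 (nsnd (nsnd z))));
    [recur|recur|by []|by move=> a m; rewrite !npairE].
exact: (recursive2_comp H recursive_id recursive_id).
Qed.
#[global] Hint Resolve recursive_cst_code : rec_db.

Definition smn u v := comp_code u (pair_code (cst_code v) (pair_code 2 3)).

Lemma recursive_smn : recursive2 smn.
Proof. by rewrite /recursive2 /smn; recur. Qed.
#[global] Hint Resolve recursive_smn : rec_db.

Lemma computes_smn u v x y : computes (smn u v) x y <-> computes u (npair v x) y.
Proof.
have h : computes (pair_code (cst_code v) (pair_code 2 3)) x (npair v x).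
  apply: computes_pair (computes_cst v x) _; rewrite -[in X in computes _ _ X](npairK x).
  exact: computes_pair (computes_nfst x) (computes_nsnd x).
split; last exact: computes_comp.
by case/computes_compE => w /(computes_fun h) <-.
Qed.

(* Kleene's recursion theorem, for the program that searches for a [y] with
   [P e x y], where [e] is its own index. *)
Lemma sigma1_fixpoint (P : nat -> nat -> nat -> Prop) :
    sigma1 (fun z => P (nfst z) (nfst (nsnd z)) (nsnd (nsnd z))) ->
  exists e, forall x, (forall y, computes e x y -> P e x y) /\
    ((exists y, P e x y) -> exists y, computes e x y).
Proof.
move=> hP.
have [|q hq] := @sigma1_index
    (fun z y => P (smn (nfst z) (nfst z)) (nsnd z) y).
  have /(sigma1_comp hP) : recursive (fun w =>
    npair (smn (nfst (nfst w)) (nfst (nfst w))) (npair (nsnd (nfst w)) (nsnd w))).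
    by recur.
  by apply: sigma1_ext => w; rewrite !npairE.
(* Diagonal: [q] expects a code [u] and searches on behalf of the program [smn u u]; feeding it [q]
   makes that program [smn q q] itself. *)
exists (smn q q) => x; have := hq (npair q x); rewrite !npairE => -[h1 h2].
split=> [y /computes_smn /h1//|/h2[y hy]].
by exists y; apply/computes_smn.
Qed.

(** * Computable reals *)

Local Open Scope classical_set_scope.
Local Open Scope ring_scope.

(** Names the position at which the error radius of a sequence with bound [k] drops below [eps]:
    [c * k] works since [c * k < 2 ^ (c * k)]. *)
Lemma dyadic_lt (K : numFieldType) (eps : K) (c k : nat) :
  0 < eps -> eps^-1 < c%:R -> 2 ^- (c * k) * k%:R < eps.
Proof.
move=> e0 hc; have [->|k0] := posnP k; first by rewrite mulr0.
rewrite mulrC ltr_pdivrMr ?exprn_gt0// -ltr_pdivrMl//.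
apply: (@lt_le_trans _ _ (c%:R * k%:R)); first by rewrite ltr_pM2r ?ltr0n.
by rewrite -natrM -natrX ler_nat ltnW// ltn_expl.
Qed.

Section Scalars.
Variables (R : realType) (K : numFieldType) (sc : scalars R K).

Definition re (z : K) : R :=
  match sc in scalars _ K return K -> R with
  | RealScalars => fun x => x
  | ComplexScalars => fun x => complex.Re x
  end z.

Lemma of_realK x : re (of_real sc x) = x.
Proof. by rewrite /re; case: sc. Qed.

Lemma reK z : 0 <= z -> of_real sc (re z) = z.
Proof.
rewrite /re; case: sc z => //= -[x y]; rewrite lecE /= => /andP[/eqP-> _].
by [].
Qed.

Lemma of_realD x y : of_real sc (x + y) = of_real sc x + of_real sc y.
Proof. by case: sc => //=; rewrite rmorphD. Qed.

Lemma of_realM x y : of_real sc (x * y) = of_real sc x * of_real sc y.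
Proof. by case: sc => //=; rewrite rmorphM. Qed.

Lemma of_realN x : of_real sc (- x) = - of_real sc x.
Proof. by case: sc => //=; rewrite rmorphN. Qed.

Lemma of_real1 : of_real sc 1 = 1.
Proof. by case: sc. Qed.

Lemma of_real0 : of_real sc 0 = 0.
Proof. by case: sc. Qed.

Lemma of_real_nat n : of_real sc n%:R = n%:R.
Proof. by case: sc => //=; rewrite rmorph_nat. Qed.

Lemma of_real_expV k : of_real sc (2 ^- k) = 2 ^- k.
Proof. by case: sc => //=; rewrite fmorphV rmorphXn /= rmorph_nat. Qed.

Lemma of_real_le x y : (of_real sc x <= of_real sc y) = (x <= y).
Proof. by case: sc => //=; rewrite lecR. Qed.

Lemma of_real_lt x y : (of_real sc x < of_real sc y) = (x < y).
Proof. by case: sc => //=; rewrite ltcR. Qed.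

Lemma of_real_norm x : `|of_real sc x| = of_real sc `|x|.
Proof.
have [x0|x0] := lerP 0 x.
  by rewrite (ger0_norm x0) ger0_norm// -of_real0 of_real_le.
by rewrite (ltr0_norm x0) of_realN ltr0_norm// -of_real0 of_real_lt.
Qed.

Lemma rational_of_real (q : rat) : rational_scalars sc (of_real sc (ratr q)).
Proof. by case: sc => /=; [exists q|exists q, 0; rewrite rmorph0]. Qed.

Lemma rational_scalarsM z w : rational_scalars sc z -> rational_scalars sc w ->
  rational_scalars sc (z * w).
Proof.
case: sc z w => /= z w.
  by move=> [p ->] [q ->]; exists (p * q); rewrite rmorphM.
move=> [p [p' ->]] [q [q' ->]]; exists (p * q - p' * q'), (p * q' + p' * q).
by rewrite rmorphB rmorphD !rmorphM.
Qed.

Lemma computable_of_real x : computable_real_seq x ->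
  computable_scalar_seq sc (fun i => of_real sc (x i)).
Proof.
case: sc => //= hx; split=> //; exists (fun=> 0); split.
  exists (fun=> 0%N), (fun=> 0%N), (fun=> 1%N); split; [recur..|].
  by move=> n; rewrite mulr0 mul0r.
by move=> n k; rewrite rmorph0 subrr normr0 invr_ge0 exprn_ge0.
Qed.

Lemma computable_re z : computable_scalar_seq sc z ->
  computable_real_seq (fun i => re (z i)).
Proof. by rewrite /re; case: sc z => //= z []. Qed.

End Scalars.

Section ComputableReals.
Variable R : realType.
Implicit Types x y : nat -> R.

Lemma exp2V_small (eps : R) : 0 < eps -> exists k : nat, 2 ^- k < eps.
Proof.
move=> e0; pose c := (Num.Def.truncn eps^-1).+1; exists (c * 1)%N.
by have := @dyadic_lt R eps c 1 e0; rewrite mulr1; apply; rewrite truncnS_gt.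
Qed.

(** Writing the signed numerator as a difference of naturals lets rationals be compared in natural
    arithmetic without sign cases. *)
Lemma computable_rat_seq_diff r : computable_rat_seq r ->
  exists p m q : nat -> nat, [/\ recursive p, recursive m, recursive q &
    forall n, (q n != 0)%N /\ r n = ((p n)%:R - (m n)%:R) / (q n)%:R].
Proof.
move=> [s [p [q [hs hp hq rE]]]].
exists (fun n => if (s n %% 2 == 0)%N then p n else 0%N).
exists (fun n => if (s n %% 2 == 0)%N then 0%N else p n).
exists q; split => //; [recur_if..|].
move=> n; have [q0 ->] := rE n; split=> //.
rewrite -signr_odd modn2; case: (odd (s n)) => /=.
  by rewrite expr1 sub0r mulN1r.
by rewrite expr0 subr0 mul1r.
Qed.

(** A strict inequality is confirmed by some precision [k] at which the rational approximations
    differ by more than both errors together. Clearing denominators turns this test into a decidable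
    relation on naturals. *)
Lemma sigma1_ltr x y : computable_real_seq x -> computable_real_seq y ->
  sigma1 (fun i => x i < y i).
Proof.
move=> [r [/computable_rat_seq_diff[p [m [q [hp hm hq rE]]]] rx]].
move=> [r' [/computable_rat_seq_diff[p' [m' [q' [hp' hm' hq' rE']]]] ry]].
have : sigma1 (fun i => exists k, (
   (p (npair i k) * q' (npair i k) + m' (npair i k) * q (npair i k)) * 2 ^ k
     + 2 * q (npair i k) * q' (npair i k) <
   (p' (npair i k) * q (npair i k) + m (npair i k) * q' (npair i k)) * 2 ^ k)%N).
  by apply: sigma1_ex; apply: sigma1_dec; recur.
apply: sigma1_ext => i.
suff E k : (((p (npair i k) * q' (npair i k) + m' (npair i k) * q (npair i k)) * 2 ^ k
     + 2 * q (npair i k) * q' (npair i k) <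
   (p' (npair i k) * q (npair i k) + m (npair i k) * q' (npair i k)) * 2 ^ k)%N)
   = ((ratr (r (npair i k)) : R) + 2 * 2 ^- k < ratr (r' (npair i k))).
  split=> [[k]|xy].
    rewrite E; have := rx i k; have := ry i k.
    by rewrite !ler_norml => /andP[? ?] /andP[? ?]; lra.
  (* A quarter: the required gap costs [2 * 2 ^- k], and each of the two approximations may lose
     another [2 ^- k]. *)
  have [k hk] : exists k : nat, 2 ^- k < (y i - x i) / 4.
    by apply: exp2V_small; lra.
  exists k; rewrite E; have := rx i k; have := ry i k.
  by rewrite !ler_norml => /andP[? ?] /andP[? ?]; lra.
have [q0 ->] := rE (npair i k); have [q0' ->] := rE' (npair i k).
move: (p _) (m _) (q _) (p' _) (m' _) (q' _) q0 q0' => P M Q P' M' Q' Q0 Q0'.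
rewrite !fmorph_div !rmorphB /= !ratr_nat -(ltr_nat R) !natrM !natrD !natrM natrX.
have D0 : (0 : R) < 2 ^+ k by rewrite exprn_gt0.
have Qp : (0 : R) < Q%:R by rewrite ltr0n lt0n.
have Qp' : (0 : R) < Q'%:R by rewrite ltr0n lt0n.
rewrite -[RHS](ltr_pM2r (mulr_gt0 (mulr_gt0 Qp Qp') D0)).
rewrite -[LHS]subr_gt0 -[RHS]subr_gt0; congr (_ < _); field; lra.
Qed.

Lemma computable_real_rat (s p q : nat -> nat) :
    recursive s -> recursive p -> recursive q -> (forall n, q n != 0)%N ->
  computable_real_seq (fun n => (-1) ^+ s n * (p n)%:R / (q n)%:R : R).
Proof.
move=> hs hp hq q0.
exists (fun z => (-1) ^+ s (nfst z) * (p (nfst z))%:R / (q (nfst z))%:R); split.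
  exists (fun z => s (nfst z)), (fun z => p (nfst z)), (fun z => q (nfst z)).
  by split=> //; recur.
move=> n k; rewrite npairE fmorph_div rmorphM /= rmorph_sign !ratr_nat subrr.
by rewrite normr0 invr_ge0 exprn_ge0.
Qed.

Lemma computable_real_frac (p q : nat -> nat) :
    recursive p -> recursive q -> (forall n, q n != 0)%N ->
  computable_real_seq (fun n => (p n)%:R / (q n)%:R : R).
Proof.
move=> hp hq q0; have := computable_real_rat (recursive_cst 0) hp hq q0.
by congr computable_real_seq; apply/funext => n; rewrite expr0 mul1r.
Qed.

Lemma computable_real_dyadic (m k : nat -> nat) : recursive m -> recursive k ->
  computable_real_seq (fun n => 2 ^- m n * (k n)%:R : R).
Proof.
move=> hm hk; have := @computable_real_frac k (fun n => 2 ^ m n)%N hk.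
have -> : (fun n => 2 ^- m n * (k n)%:R) =
    (fun n => (k n)%:R / (2 ^ m n)%:R) :> (nat -> R).
  by apply/funext => n; rewrite natrX mulrC.
by apply; [recur|move=> n; rewrite -lt0n expn_gt0].
Qed.

Lemma computable_real_select x (b : nat -> bool) h : computable_real_seq x ->
    recursive (fun i => (b i : nat)) -> recursive h ->
  computable_real_seq (fun i => if b i then x (h i) else 0).
Proof.
move=> [r [[s [p [q [hs hp hq rE]]]] rx]] hb hh.
pose t z := npair (h (nfst z)) (nsnd z).
have ht : recursive t by rewrite /t; recur.
exists (fun z => if b (nfst z) then r (t z) else 0); split.
  exists (fun z => s (t z)), (fun z => if b (nfst z) then p (t z) else 0%N).
  exists (fun z => q (t z)); split; [recur| |recur|].
    by apply: recursive_if; [exact: (recursive_comp hb (recursive_nfst recursive_id))|recur|recur].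
  move=> z; have [q0 ->] := rE (t z); split=> //.
  by case: (b _); rewrite // mulr0 mul0r.
move=> n k; rewrite /t !npairE; case: (b n) => //.
by rewrite rmorph0 subrr normr0 invr_ge0 exprn_ge0.
Qed.

Lemma computable_real_cst (c : R) (p q : nat -> nat) :
    recursive p -> recursive q -> (forall k, q k != 0)%N ->
    (forall k, `|(p k)%:R / (q k)%:R - c| <= 2 ^- k) ->
  computable_real_seq (fun=> c).
Proof.
move=> hp hq q0 pc; exists (fun z => (p (nsnd z))%:R / (q (nsnd z))%:R); split.
  exists (fun=> 0%N), (fun z => p (nsnd z)), (fun z => q (nsnd z)).
  by split; [recur..|] => z; rewrite mul1r.
by move=> n k; rewrite npairE fmorph_div /= !ratr_nat.
Qed.

Lemma computable_sqrt2 : computable_real_seq (fun=> Num.sqrt 2 : R).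
Proof.
(* The integer part of [2 ^ k] times the square root of 2, so that [p k / 2 ^ k] has error at most
   [2 ^- k]. *)
pose p k := PeanoNat.Nat.sqrt (2 * 4 ^ k).
have pE k : (p k * p k <= 2 * 4 ^ k < (p k).+1 * (p k).+1)%N.
  have [] := PeanoNat.Nat.sqrt_spec (2 * 4 ^ k)%N (PeanoNat.Nat.le_0_l _).
  by rewrite -/(p k); lia.
move: p pE => p pE.
apply: (@computable_real_cst _ p (fun k => 2 ^ k)%N);
  [|recur|by move=> k; rewrite -lt0n expn_gt0|].
  apply: (recursive_search
    (b := fun k j => (j * j <= 2 * 4 ^ k) && (2 * 4 ^ k < j.+1 * j.+1))%N).
  - by rewrite /recursive2; recur_if.
  - exact: pE.
  - by move=> k j /andP[]; have /andP[] := pE k; nia.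
move=> k; have /andP[] := pE k; rewrite -(ler_nat R) -(ltr_nat R).
rewrite natrX !natrM natrX (_ : 4 = 2 * 2)//; last by rewrite -natrM.
rewrite exprMn -[(p k).+1%:R]natr1; set D : R := 2 ^+ k; set P : R := (p k)%:R => h1 h2.
have D0 : 0 < D by rewrite exprn_gt0.
have P0 : 0 <= P by rewrite ler0n.
have s0 : 0 <= Num.sqrt 2 :> R by exact: sqrtr_ge0.
have s2 : Num.sqrt 2 * Num.sqrt 2 = 2 :> R by rewrite -expr2 sqr_sqrtr.
have l1 : P <= Num.sqrt 2 * D.
  rewrite -ler_sqr ?nnegrE ?mulr_ge0 ?(ltW D0)//.
  by rewrite !expr2 mulrACA s2.
have l2 : Num.sqrt 2 * D <= P + 1.
  rewrite -ler_sqr ?nnegrE ?mulr_ge0 ?(ltW D0)//; last by lra.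
  by rewrite !expr2 mulrACA s2 ltW.
have -> : P / D - Num.sqrt 2 = (P - Num.sqrt 2 * D) / D by field; lra.
rewrite normrM normfV (gtr0_norm D0) -[leRHS]mul1r ler_pM2r ?invr_gt0//.
by rewrite ler_norml; lra.
Qed.

End ComputableReals.

(** * Effective Banach spaces *)

Section EffectiveBanachSpace.
Variables (R : realType) (K : numFieldType) (sc : scalars R K).
Variable X : completeNormedModType K.

(** Norms live in [K], which may be [R[i]]; they are moved to [R], where the order is total and
    computable real sequences are defined. *)
Definition nrm (x : X) : R := re sc `|x|.

Lemma of_real_nrm x : of_real sc (nrm x) = `|x|.
Proof. exact: reK. Qed.

Lemma nrm_ge0 x : 0 <= nrm x.
Proof. by rewrite -(of_real_le sc) of_real_nrm of_real0. Qed.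

Lemma nrm_gt0 x : x <> 0 -> 0 < nrm x.
Proof.
by move=> /eqP x0; rewrite -(of_real_lt sc) of_real_nrm of_real0 normr_gt0.
Qed.

Lemma nrmZ c x : nrm (of_real sc c *: x) = `|c| * nrm x.
Proof.
by rewrite -[RHS](of_realK sc) of_realM of_real_nrm -of_real_norm /nrm normrZ.
Qed.

Lemma ler_nrmD x y : nrm (x + y) <= nrm x + nrm y.
Proof.
by rewrite -(of_real_le sc) of_realD !of_real_nrm ler_normD.
Qed.

Lemma nrmN x : nrm (- x) = nrm x.
Proof. by rewrite /nrm normrN. Qed.

Lemma nrmB x y : nrm (x - y) = nrm (y - x).
Proof. by rewrite -nrmN opprB. Qed.

Lemma of_realBZ c d (x : X) :
  of_real sc c *: x - of_real sc d *: x = of_real sc (c - d) *: x.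
Proof. by rewrite -scalerBl -of_realN -of_realD. Qed.

Lemma bounded_linear_scale c : bounded_linear (fun x : X => of_real sc c *: x).
Proof.
split; first by move=> k x y; rewrite scalerDr !scalerA mulrC.
by exists `|of_real sc c| => x; rewrite normrZ.
Qed.

Variables (S : set (nat -> X)) (hS : computability_structure sc S).

Lemma computable_lin (x y : nat -> X) (f g : nat -> nat) (c d : nat -> R) :
    S x -> S y -> recursive f -> recursive g ->
    computable_real_seq c -> computable_real_seq d ->
  S (fun n => of_real sc (c n) *: x (f n) + of_real sc (d n) *: y (g n)).
Proof.
move=> Sx Sy hf hg hc hd.
(* The linear forms axiom only offers sums over initial segments. Coefficients that vanish off [h n]
   pick out one term, and [f n + g n] is a length covering both chosen terms. *)
pose al (h : nat -> nat) (c : nat -> R) n k :=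
  of_real sc (if k == h n then c n else 0).
have hal h b : recursive h -> computable_real_seq b ->
    computable_scalar_seq sc (fun i => al h b (nfst i) (nsnd i)).
  move=> hh hb; apply: computable_of_real.
  apply: (computable_real_select (b := fun i => nsnd i == h (nfst i)) hb).
    by recur.
  by recur.
have hfg : recursive (fun n => f n + g n)%N by recur.
have := linear_forms_axiom hS Sx Sy (hal _ _ hf hc) (hal _ _ hg hd) hfg.
have sumE h b (z : nat -> X) n m : (h n <= m)%N ->
    \sum_(k < m.+1) al h b n k *: z k = of_real sc (b n) *: z (h n).
  move=> hm; rewrite (bigD1 (Ordinal (n := m.+1) (m := h n) hm)) //= {1}/al eqxx.
  rewrite big1 ?addr0// => k; rewrite -val_eqE /= => kh.
  by rewrite /al (negPf kh) of_real0 scale0r.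
congr (S _); apply/funext => n; rewrite big_split /= !sumE ?leq_addl//.
by rewrite leq_addr.
Qed.

Lemma computable_nrm x : S x -> computable_real_seq (fun n => nrm (x n)).
Proof. by move=> /(norms_axiom hS)/computable_re. Qed.

Lemma computable_real_cst_rat s p q : q != 0%N ->
  computable_real_seq (fun=> (-1) ^+ s * p%:R / q%:R : R).
Proof. by move=> q0; apply: computable_real_rat => //; recur. Qed.

Lemma computable_real1 : computable_real_seq (fun=> 1 : R).
Proof.
by have := @computable_real_cst_rat 0 1 1 isT; rewrite expr0 mul1r divr1.
Qed.

Lemma computable_realN1 : computable_real_seq (fun=> -1 : R).
Proof.
by have := @computable_real_cst_rat 1 1 1 isT; rewrite expr1 mulN1r divr1.
Qed.

Lemma computable_linB (x y : nat -> X) (f g : nat -> nat) (c : nat -> R) :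
    S x -> S y -> recursive f -> recursive g -> computable_real_seq c ->
  S (fun n => of_real sc (c n) *: x (f n) - y (g n)).
Proof.
move=> Sx Sy hf hg hc.
have := computable_lin Sx Sy hf hg hc computable_realN1; congr (S _).
by apply/funext => n; rewrite of_realN of_real1 scaleN1r.
Qed.

Lemma computable_sub (x y : nat -> X) (f g : nat -> nat) :
    S x -> S y -> recursive f -> recursive g ->
  S (fun n => x (f n) - y (g n)).
Proof.
move=> Sx Sy hf hg; have := computable_linB Sx Sy hf hg computable_real1.
by congr (S _); apply/funext => n; rewrite of_real1 scale1r.
Qed.

Lemma computable_scale (x : nat -> X) (f : nat -> nat) (c : nat -> R) :
    S x -> recursive f -> computable_real_seq c ->
  S (fun n => of_real sc (c n) *: x (f n)).
Proof.
move=> Sx hf hc.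
have := computable_lin Sx Sx hf hf hc (@computable_real_cst_rat 0 0 1 isT).
congr (S _); apply/funext => n.
by rewrite mulr0 mul0r of_real0 scale0r addr0.
Qed.

Lemma computable_reindex (x : nat -> X) (f : nat -> nat) :
  S x -> recursive f -> S (fun n => x (f n)).
Proof.
move=> Sx hf; have := computable_scale Sx hf computable_real1.
by congr (S _); apply/funext => n; rewrite of_real1 scale1r.
Qed.

Lemma computable_elements_scale c : computable_real_seq (fun=> c) ->
  (fun x : X => of_real sc c *: x) @` computable_elements S `<=`
    computable_elements S.
Proof.
move=> hc _ [x Sx <-]; exact: computable_scale Sx recursive_id hc.
Qed.

Variables (e a : nat -> X) (ha : S a) (haA : range a = rational_span sc e).

Lemma rational_span0 : rational_span sc e 0.
Proof.
exists 0%N, (fun=> 0); rewrite big_ord0; split=> // i.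
by have := rational_of_real sc 0; rewrite rmorph0 of_real0.
Qed.

Lemma rational_spanZ (q : rat) x : rational_span sc e x ->
  rational_span sc e (of_real sc (ratr q) *: x).
Proof.
move=> [N [c [hc ->]]]; exists N, (fun i => of_real sc (ratr q) * c i); split.
  by move=> i; apply: rational_scalarsM => //; exact: rational_of_real.
by rewrite scaler_sumr; apply: eq_bigr => i _; rewrite scalerA.
Qed.

Lemma span_index x : rational_span sc e x -> exists n, a n = x.
Proof. by rewrite -haA => -[n _ <-]; exists n. Qed.

Lemma in_span n : rational_span sc e (a n).
Proof. by rewrite -haA; exists n. Qed.

Lemma scale_approx c j (eps : R) : 0 < eps ->
  exists m, nrm (of_real sc c *: a j - a m) < eps.
Proof.
move=> e0; have n0 := nrm_ge0 (a j).
pose d := eps / (nrm (a j) + 1).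
have d0 : 0 < d by rewrite divr_gt0// ltr_wpDl.
have [|q] := @rat_in_itvoo R c (c + d); first by rewrite ltrDl.
rewrite in_itv /= => /andP[q1 q2].
have [m am] := span_index (rational_spanZ q (in_span j)).
exists m; rewrite am of_realBZ nrmZ distrC gtr0_norm ?subr_gt0//.
apply: (@le_lt_trans _ _ (d * nrm (a j))).
  by rewrite ler_wpM2r// lerBlDl ltW.
rewrite /d mulrAC ltr_pdivrMr ?ltr_wpDl// mulrDr mulr1.
by rewrite ltrDl.
Qed.

Lemma span_unbounded (M : R) x : rational_span sc e x -> x <> 0 ->
  exists m, M < nrm (a m).
Proof.
move=> Ax x0; have n0 := nrm_gt0 x0.
have [m am] := span_index (rational_spanZ (Num.Def.truncn (M / nrm x)).+1%:R Ax).
exists m; rewrite am nrmZ ratr_nat ger0_norm// -ltr_pdivrMr//.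
have [M0|M0] := lerP 0 M; first by rewrite truncnS_gt// divr_ge0// ltW.
by apply: lt_le_trans (ler0n _ _); rewrite pmulr_llt0 ?invr_gt0.
Qed.

Lemma sigma1_nrm_lt x y : S x -> S y -> sigma1 (fun i => nrm (x i) < nrm (y i)).
Proof. by move=> Sx Sy; apply: sigma1_ltr; exact: computable_nrm. Qed.

(** The new name reads the old one two places ahead. Since the square root of 2 is below 2, the old
    error contributes at most [2 ^- n.+1], and replacing the scaled vector by a nearby member of A,
    found by search, costs less than another [2 ^- n.+1]. *)
Lemma effective_scale_sqrt2 :
  effective a (fun x : X => of_real sc (Num.sqrt 2) *: x).
Proof.
have s0 : 0 <= Num.sqrt 2 :> R by exact: sqrtr_ge0.
have s2 : Num.sqrt 2 < 2 :> R.
  by rewrite -ltr_sqr ?nnegrE// sqr_sqrtr// expr2; lra.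
have [G hG GE] : exists2 G, recursive G & forall z,
    nrm (of_real sc (Num.sqrt 2) *: a (nfst z) - a (G z)) < 2 ^- (nsnd z).+1.
  apply: (@sigma1_choice (fun z m =>
    nrm (of_real sc (Num.sqrt 2) *: a (nfst z) - a m) < 2 ^- (nsnd z).+1)).
    apply: sigma1_ltr; last first.
      have : computable_real_seq (fun z => 2 ^- (nsnd (nfst z)).+1 * 1%:R : R).
        by apply: computable_real_dyadic; recur.
      by congr computable_real_seq; apply/funext => z; rewrite mulr1.
    apply: computable_nrm.
    apply: (@computable_linB a a (fun z => nfst (nfst z)) (fun z => nsnd z)
              (fun=> Num.sqrt 2)) => //; [recur|recur|exact: computable_sqrt2].
  by move=> z; apply: scale_approx; rewrite invr_gt0 exprn_gt0.
have [g hg] := hG; have [d hd] : recursive (fun n => n.+2) by recur.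
have [i hi] := recursive_id.
pose p e := comp_code g (pair_code (comp_code e d) i).
have [q hq] : recursive p by rewrite /p; recur.
exists q => c x [f [hf _ fx]]; exists (p c); split; first exact: hq.
have dist n : nrm (a (G (npair (f n.+2) n)) - of_real sc (Num.sqrt 2) *: x) < 2 ^- n.
  have := GE (npair (f n.+2) n); rewrite !npairE nrmB.
  set u := a (G _); set w := a (f n.+2) => uw.
  have : nrm (of_real sc (Num.sqrt 2) *: (w - x)) <= 2 ^- n.+1.
    rewrite nrmZ ger0_norm//.
    apply: (@le_trans _ _ (2 * nrm (w - x))).
      by rewrite ler_wpM2r ?nrm_ge0// ltW.
    have := fx n.+2; rewrite -/w -of_real_nrm -(of_real_expV sc) of_real_lt.
    move/ltW/(ler_wpM2l (ler0n R 2)).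
    by rewrite [2 ^+ n.+2]exprS invfM mulrA mulfV ?mul1r// pnatr_eq0.
  rewrite scalerBr => wx.
  have := ler_nrmD (u - of_real sc (Num.sqrt 2) *: w)
    (of_real sc (Num.sqrt 2) *: w - of_real sc (Num.sqrt 2) *: x).
  rewrite addrA subrK => h.
  have -> : (2 : R) ^- n = 2 ^- n.+1 + 2 ^- n.+1.
    by rewrite exprS invfM; field; rewrite expf_neq0// pnatr_eq0.
  by lra.
exists (fun n => G (npair (f n.+2) n)); split.
- move=> n; apply: computes_comp (hg _).
  by apply: computes_pair (hi n); apply: computes_comp (hd n) (hf _).
- apply/cvgrPdist_lt => eps eps0.
  have [k hk] : exists k : nat, 2 ^- k < re sc eps.
    apply: exp2V_small; rewrite -(of_real_lt sc) reK ?of_real0// ltW//.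
  near=> n; rewrite distrC -of_real_nrm -(reK sc (ltW eps0)) of_real_lt.
  apply: lt_trans (dist n) (le_lt_trans _ hk).
  rewrite lef_pV2 ?posrE ?exprn_gt0// ler_eXn2l ?ltr1n//.
  by near: n; exact: nbhs_infty_ge.
- by move=> n; rewrite -of_real_nrm -(of_real_expV sc) of_real_lt; exact: dist.
Unshelve. all: by end_near.
Qed.

End EffectiveBanachSpace.

(** * A computable scalar moving a given vector out of the rational span *)

Section Diagonal.
Variables (R : realType) (K : numFieldType) (sc : scalars R K).
Variables (X : completeNormedModType K) (S : set (nat -> X)).
Hypothesis hS : computability_structure sc S.
Variables (a : nat -> X) (ha : S a).

(* The base 4 digits of [c], each 0 or 1, are chosen so that [c *: a v] avoids
   [a 0], [a 1], ... in turn: two candidate prefixes of length [n + 1] move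
   [c *: a v] by [4 ^- n.+1 * nrm (a v)], so one of them stays away from [a n]
   by more than a third of this, which is all that the later digits can undo. *)
Lemma scale_avoiding v : a v <> 0 ->
  exists2 c : R, computable_real_seq (fun=> c) &
    forall n, of_real sc c *: a v <> a n.
Proof.
move=> /(nrm_gt0 sc) v0.
pose u (n s : nat) : R := s%:R / 4 ^+ n.
have p4 n : (0 : R) < 4 ^- n by rewrite invr_gt0 exprn_gt0.
have p4S n : (4 : R) ^- n = 4 * 4 ^- n.+1.
  by rewrite exprS invfM mulrA mulfV ?mul1r// pnatr_eq0.
(* The separation is demanded as a strict inequality, so a suitable digit can be found by search.
   One exists because the two candidates cannot both lie within a third of their mutual distance
   from [a n]. *)
have [f hf fE] : exists2 f, recursive f & forall z, (f z <= 1)%N /\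
    nrm sc (of_real sc (4 ^- (nfst z).+1 / 3) *: a v) <
    nrm sc (of_real sc (u (nfst z).+1 (4 * nsnd z + f z)%N) *: a v - a (nfst z)).
  apply: (@sigma1_choice (fun z b => (b <= 1)%N /\
    nrm sc (of_real sc (4 ^- (nfst z).+1 / 3) *: a v) <
    nrm sc (of_real sc (u (nfst z).+1 (4 * nsnd z + b)%N) *: a v - a (nfst z)))).
    apply: sigma1_and; first by apply: sigma1_dec; recur.
    apply: (sigma1_nrm_lt hS).
      apply: (computable_scale hS (x := a) (f := fun=> v)
        (c := fun z => 4 ^- (nfst (nfst z)).+1 / 3)) => //; first by recur.
      have : computable_real_seq
          (fun z => 1%:R / (4 ^ (nfst (nfst z)).+1 * 3)%:R : R).
        apply: computable_real_frac; [recur..|] => n.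
        by rewrite -lt0n muln_gt0 expn_gt0.
      congr computable_real_seq; apply/funext => z.
      by rewrite mul1r natrM natrX invfM.
    apply: (computable_linB hS (x := a) (y := a) (f := fun=> v)
      (g := fun z => nfst (nfst z))
      (c := fun z => u (nfst (nfst z)).+1 (4 * nsnd (nfst z) + nsnd z)%N)) => //;
      [recur|recur|].
    have : computable_real_seq (fun z => (4 * nsnd (nfst z) + nsnd z)%:R /
        (4 ^ (nfst (nfst z)).+1)%:R : R).
      apply: computable_real_frac; [recur..|] => n.
      by rewrite -lt0n expn_gt0.
    by congr computable_real_seq; apply/funext => z; rewrite natrX.
  move=> z; set n := nfst z; set s := nsnd z.
  set y := fun b => of_real sc (u n.+1 (4 * s + b)%N) *: a v - a n.
  have y01 : nrm sc (y 1%N - y 0%N) = 4 ^- n.+1 * nrm sc (a v).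
    rewrite /y opprB addrA subrK of_realBZ nrmZ /u -mulrBl natrD addn0.
    by rewrite addrAC subrr add0r mul1r gtr0_norm.
  have := ler_nrmD sc (y 1%N) (- y 0%N); rewrite y01 nrmN => yy.
  rewrite nrmZ ger0_norm ?divr_ge0 ?(ltW (p4 _))//.
  have pv : 0 < 4 ^- n.+1 * nrm sc (a v) by rewrite mulr_gt0.
  rewrite mulrAC; have [y0|y0] := ltP (4 ^- n.+1 * nrm sc (a v) / 3) (nrm sc (y 0%N)).
    by exists 0%N.
  by exists 1%N; split=> //; rewrite -/(y 1%N); lra.
pose s := fix s n := if n is n'.+1 then (4 * s n' + f (npair n' (s n')))%N else 0%N.
have hs : recursive s.
  have H : recursive2 (fun=> s).
    apply: (@recursive_primrec _ (fun=> 0%N)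
      (fun z => 4 * nsnd (nsnd z) + f (npair (nfst (nsnd z)) (nsnd (nsnd z))))%N);
    [recur|recur|by []|by move=> b m; rewrite !npairE].
  exact: (recursive2_comp H recursive_id recursive_id).
(* The intervals from [u n (s n)] to [u n (s n) + 4 ^- n / 3] are nested. The length is the value of
   a tail consisting only of digits 1, the largest possible continuation. *)
have uS n : u n (s n) <= u n.+1 (s n.+1) /\
    u n.+1 (s n.+1) + 4 ^- n.+1 / 3 <= u n (s n) + 4 ^- n / 3.
  have := (fE (npair n (s n))).1; rewrite /u /= -(ler_nat R) natrD natrM.
  move: (f _)%:R (ler0n R (f (npair n (s n)))) => b b0 b1.
  rewrite p4S; have := p4 n.+1; move: (4 ^- n.+1) => D D0.
  by split; nra.
have uD n m : u n (s n) <= u (n + m)%N (s (n + m)%N) /\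
    u (n + m)%N (s (n + m)%N) + 4 ^- (n + m) / 3 <= u n (s n) + 4 ^- n / 3.
  elim: m => [|m [IH1 IH2]]; first by rewrite addn0.
  rewrite addnS; have [h1 h2] := uS (n + m)%N.
  by split; [exact: le_trans h1|exact: le_trans IH2].
have uub n m : u m (s m) <= u n (s n) + 4 ^- n / 3.
  have [mn|nm] := leqP m n.
    have [+ _] := uD m (n - m)%N; rewrite subnKC// => h.
    by have := p4 n; lra.
  have [_] := uD n (m - n)%N; rewrite subnKC ?(ltnW nm)// => h.
  by have := p4 m; lra.
pose U := range (fun n => u n (s n)).
have U0 : U !=set0 by exists (u 0%N (s 0%N)), 0%N.
pose c : R := sup U.
have cub n : c <= u n (s n) + 4 ^- n / 3.
  by apply: sup_le_ub => // _ [m _ <-]; exact: uub.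
have clb n : u n (s n) <= c.
  apply: ub_le_sup; last by exists n.
  by exists (u 0%N (s 0%N) + 4 ^- 0 / 3) => _ [m _ <-]; exact: uub.
have cE n : `|u n (s n) - c| <= 4 ^- n / 3.
  by have := cub n; have := clb n; have := p4 n; rewrite ler_norml; lra.
exists c.
  apply: (@computable_real_cst _ _ s (fun k => 4 ^ k)%N); [by []|recur| |] => k.
    by rewrite -lt0n expn_gt0.
  rewrite natrX; apply: le_trans (cE k) _.
  apply: (@le_trans _ _ (4 ^- k)); first by have := p4 k; lra.
  by rewrite lef_pV2 ?posrE ?exprn_gt0// lerXn2r ?nnegrE ?ler_nat.
move=> n cn; have [_] := fE (npair n (s n)); rewrite !npairE -cn of_realBZ !nrmZ.
rewrite ltr_pM2r// ltNge => /negP; apply.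
rewrite [leRHS]ger0_norm; last by rewrite divr_ge0// ltW.
exact: (cE n.+1).
Qed.

End Diagonal.

(** * The numbering beta *)

Section Beta.
Variables (K : numFieldType) (X : completeNormedModType K) (a : nat -> X).

(** The stage-free counterpart of [eligible]: the sequence legitimately reaches position [m]. Only
    the values of [f] up to [m] matter. *)
Definition good e k m (f : nat -> nat) :=
  (forall l, (l <= m)%N -> computes e l (f l)) /\
  (forall l, (l < m)%N -> `|a (f l.+1) - a (f l)| < 2 ^- l.+1 * k%:R).

Lemma good_le e k m m' f : (m' <= m)%N -> good e k m f -> good e k m' f.
Proof.
by move=> mm' [h1 h2]; split=> l lm; [apply: h1|apply: h2]; lia.
Qed.

Lemma good_dist e k m p f : (m <= p)%N -> good e k p f ->
  `|a (f p) - a (f m)| <= 2 ^- m * k%:R.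
Proof.
move=> mp gp.
have e0 n : (0 : K) <= 2 ^- n * k%:R by rewrite mulr_ge0// invr_ge0 exprn_ge0.
(* Keeping the negative remainder of the geometric sum is what lets the induction on [p] close. *)
suff : `|a (f p) - a (f m)| <= 2 ^- m * k%:R - 2 ^- p * k%:R.
  by move/le_trans; apply; rewrite gerBl.
elim: p mp gp => [|p IH].
  by rewrite leqn0 => /eqP -> _; rewrite !subrr normr0.
rewrite leq_eqVlt => /predU1P[-> _|]; first by rewrite !subrr normr0.
rewrite ltnS => mp gp.
have := IH mp (good_le (leqnSn p) gp); have := ltW (gp.2 p (leqnn _)) => h1 h2.
rewrite -(subrKA (a (f p))); apply: le_trans (ler_normD _ _) _.
apply: le_trans (lerD h1 h2) _; rewrite le_eqVlt; apply/orP; left; apply/eqP.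
have -> : (2 : K) ^- p = 2 * 2 ^- p.+1.
  by rewrite exprS invfM mulrA mulfV ?mul1r// pnatr_eq0.
by ring.
Qed.

Lemma eligibleP e k n m : reflect
  [/\ forall l, (l <= m)%N -> halts n e l,
      forall l, (l < m)%N -> Defs.close a e k n l.+1 &
      [|| [forall n' : 'I_n, ~~ halts n' e m],
          ~~ halts n e m.+1 | ~~ Defs.close a e k n m.+1]] (eligible a e k n m).
Proof.
apply: (iffP and3P) => -[h1 h2 h3]; split=> //.
- by move=> l lm; apply: (allP h1); rewrite mem_iota.
- by move=> l lm; apply: (allP h2); rewrite mem_iota; lia.
- by apply/allP => l; rewrite mem_iota => /andP[_]; exact: h1.
- by apply/allP => -[|l]; rewrite mem_iota //= add1n ltnS; exact: h2.
Qed.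

(** The last position reached within the bounds is always eligible, since its successor is either
    not yet computed or too far away. It lies below [n] because halting within [n] steps forces the
    argument below [n], so [find] does not run off the list. *)
Lemma eligible_ex e k n : halts n e 0 ->
  eligible a e k n (find (eligible a e k n) (iota 0 n)).
Proof.
move=> h0.
pose Q m := all (halts n e) (iota 0 m.+1) && all (Defs.close a e k n) (iota 1 m).
have Q0 : exists m, Q m by exists 0%N; rewrite /Q /= h0.
have Qn m : Q m -> (m <= n)%N.
  case/andP => /allP /(_ m); rewrite mem_iota add0n leqnn => /(_ isT).
  by rewrite /halts; case E: (phi n e m) => // _ _; rewrite ltnW// (phi_lt E).
have hasE : has (eligible a e k n) (iota 0 n).
  case: (ex_maxnP Q0 Qn) => M QM Mmax; apply/hasP; exists M.
    rewrite mem_iota /=.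
    case/andP: QM => /allP /(_ M); rewrite mem_iota add0n leqnn => /(_ isT).
    by rewrite /halts; case E: (phi n e M) => // _ _; exact: phi_lt E.
  case/andP: (QM) => h1 h2; apply/and3P; split=> //.
  apply/orP; right; rewrite -negb_and; apply/negP => /andP[hM cM].
  suff /Mmax : Q M.+1 by rewrite ltnn.
  have iS i j : iota i j.+1 = iota i j ++ [:: (i + j)%N] by rewrite -addn1 iotaD.
  by rewrite /Q (iS 0%N M.+1) (iS 1%N M) !all_cat h1 h2 !all_seq1 add0n add1n hM cM.
have ltn : (find (eligible a e k n) (iota 0 n) < n)%N.
  by move: hasE; rewrite has_find size_iota.
by have := nth_find 0%N hasE; rewrite nth_iota.
Qed.

Lemma good_stage e k m f : good e k m f ->
  exists n0, forall n l, (n0 <= n)%N -> (l <= m)%N -> phi n e l = Some (f l).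
Proof.
move=> [h _]; elim: m h => [|m IH] h.
  have [n0 hn0] := h 0%N (leqnn _); exists n0 => n l n0n.
  by rewrite leqn0 => /eqP->; exact: phi_mono hn0.
have [|n0 hn0] := IH; first by move=> l lm; apply: h; lia.
have [n1 hn1] := h m.+1 (leqnn _); exists (maxn n0 n1) => n l nn.
rewrite leq_eqVlt => /predU1P[->|lm]; first by apply: phi_mono hn1; lia.
by apply: hn0; lia.
Qed.

Lemma good_fun e k m k' m' f f' : good e k m f -> good e k' m' f' ->
  forall l, (l <= m)%N -> (l <= m')%N -> f l = f' l.
Proof.
by move=> [h _] [h' _] l lm lm'; exact: computes_fun (h l lm) (h' l lm').
Qed.

(** At a late stage no position before [m] is eligible: its value is no longer new, its successor
    has been computed, and the next difference obeys the bound. So the sequence never falls back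
    behind [m]. *)
Lemma quasi_seq_good e k m f : good e k m f ->
  exists n0, forall n, (n0 <= n)%N -> exists p f',
    [/\ (m <= p)%N, good e k p f' & quasi_seq a e k n = a (f' p)].
Proof.
move=> gf; have [n0 hn0] := good_stage gf; exists n0.+1 => n n0n.
have hl l : (l <= m)%N -> phi n e l = Some (f l) by apply: hn0; lia.
have h0 : halts n e 0 by rewrite /halts hl.
have := eligible_ex k h0; rewrite /quasi_seq h0.
set p := find _ _ => /eligibleP[p1 p2 p3].
pose f' l := odflt 0%N (phi n e l).
have hf' l : (l <= p)%N -> phi n e l = Some (f' l).
  by move=> /p1; rewrite /halts /f'; case: (phi n e l).
exists p, f'; split=> //; last first.
  by split=> [l /hf'|l /p2//]; exists n.
rewrite leqNgt; apply/negP => pm; case/or3P: p3.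
(* The threshold [n0.+1] makes [n0] itself an earlier stage at which the value was already known. *)
- move/forallP => /(_ (Ordinal n0n)) /=.
  by rewrite /halts hn0// ltnW.
- by rewrite /halts hl.
- by rewrite /Defs.close /Defs.approx (hl _ pm) (hl _ (ltnW pm)) /= gf.2.
Qed.

Lemma quasi_seq_undef e k : (forall v, ~ computes e 0 v) ->
  forall n, quasi_seq a e k n = a 0%N.
Proof.
move=> h n; rewrite /quasi_seq /halts; case E: (phi n e 0) => [v|] //.
by case: (h v); exists n.
Qed.

Lemma quasi_seq_stuck e k M f : good e k M f ->
    ~ (exists f', good e k M.+1 f') ->
  quasi_seq a e k @ \oo --> a (f M).
Proof.
move=> gf ng; have [n0 hn0] := quasi_seq_good gf.
apply: cvg_near_cst; near=> n.
have [|p [f' [Mp gf' ->]]] := hn0 n; first by near: n; exact: nbhs_infty_ge.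
have pM : p = M.
  apply/eqP; rewrite eqn_leq Mp andbT leqNgt; apply/negP => lt.
  by apply: ng; exists f'; apply: good_le gf'.
by rewrite pM in gf' *; rewrite (good_fun gf gf').
Unshelve. all: by end_near.
Qed.

Hypothesis archi : forall x : K, 0 < x -> exists n : nat, x < n%:R.

Lemma quasi_seq_total e k : (forall m, exists f, good e k m f) ->
  cvg (quasi_seq a e k @ \oo).
Proof.
move=> tot; apply/cauchy_cvgP; apply: cauchy_exP => eps e0.
have [|c hc] := archi (x := eps^-1); first by rewrite invr_gt0.
have hm := dyadic_lt k e0 hc; set m := (c * k)%N in hm.
have [f gf] := tot m; have [n0 hn0] := quasi_seq_good gf.
exists (a (f m)); exists n0 => // n /= n0n; rewrite -ball_normE /=.
have [p [f' [mp gf' ->]]] := hn0 n n0n.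
rewrite (good_fun gf gf') ?leqnn// distrC.
exact: le_lt_trans (good_dist mp gf') hm.
Qed.

(** If the first value is missing the sequence is constant; if every position is reached it is
    Cauchy; otherwise, descending from an unreachable position finds the last reached one, where it
    becomes constant. *)
Lemma quasi_seq_cvg e k : cvg (quasi_seq a e k @ \oo).
Proof.
have [h0|h0] := pselect (exists v, computes e 0 v); last first.
  apply: (cvgP (a 0%N)); apply: cvg_near_cst; near=> n.
  by apply: quasi_seq_undef => v hv; apply: h0; exists v.
have [/quasi_seq_total//|] := pselect (forall m, exists f, good e k m f).
move=> /existsNP[m]; elim: m => [|m IH] ng.
  case: ng; have [v hv] := h0; exists (fun=> v); split=> // l.
  by rewrite leqn0 => /eqP->.
have [[f gf]|/IH//] := pselect (exists f, good e k m f).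
exact: cvgP (quasi_seq_stuck gf ng).
Unshelve. all: by end_near.
Qed.

Lemma beta_undef e k : (forall v, ~ computes e 0 v) -> beta a (npair e k) = a 0%N.
Proof.
move=> h; rewrite /beta !npairE; apply: cvg_lim => //.
apply: cvg_near_cst; near=> n; exact: quasi_seq_undef.
Unshelve. all: by end_near.
Qed.

Lemma beta_stuck e k M f : good e k M f -> ~ (exists f', good e k M.+1 f') ->
  beta a (npair e k) = a (f M).
Proof.
move=> gf ng; rewrite /beta !npairE; apply: cvg_lim => //.
exact: quasi_seq_stuck gf ng.
Qed.

Lemma beta_good e k m f : good e k m f ->
  `|beta a (npair e k) - a (f m)| <= 2 ^- m * k%:R.
Proof.
move=> gf; rewrite /beta !npairE; set L := lim _.
have cL : quasi_seq a e k @ \oo --> L by exact: quasi_seq_cvg.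
have r0 : (0 : K) <= 2 ^- m * k%:R by rewrite mulr_ge0// invr_ge0 exprn_ge0.
rewrite real_leNgt ?ger0_real//; apply/negP => lt.
have /cvgrPdist_lt /(_ _ (_ : 0 < `|L - a (f m)| - 2 ^- m * k%:R)) := cL.
rewrite subr_gt0 => /(_ lt) [N _ hN].
have [n0 hn0] := quasi_seq_good gf.
have [p [f' [mp gf' qE]]] := hn0 (maxn N n0) (leq_maxr _ _).
have := hN (maxn N n0) (leq_maxl _ _); rewrite /= qE ltrBrDr => h.
have := good_dist mp gf'; rewrite -(good_fun gf gf' (leqnn m) mp) => h'.
have := le_lt_trans (ler_normD _ _) (le_lt_trans (lerD (lexx _) h') h).
by rewrite subrKA ltxx.
Qed.

(** Every way of stopping, including never starting, leaves a limit among the [a n]. A limit outside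
    A therefore forces infinitely many published values. *)
Lemma beta_total e k : ~ range a (beta a (npair e k)) ->
  forall m, exists f, good e k m f.
Proof.
move=> nA; have [v hv] : exists v, computes e 0 v.
  apply: contrapT => h; apply: nA; exists 0%N => //.
  by rewrite beta_undef// => v hv; apply: h; exists v.
elim=> [|m [f gf]].
  by exists (fun=> v); split=> // l; rewrite leqn0 => /eqP->.
apply: contrapT => ng; apply: nA; exists (f m) => //.
by rewrite (beta_stuck gf ng).
Qed.

End Beta.

(** * Diagonalization against realizers on [beta]-indices *)

Section NotQuasiEffective.
Variables (R : realType) (K : numFieldType) (sc : scalars R K).
Variables (X : completeNormedModType K) (S : set (nat -> X)).
Hypothesis hS : computability_structure sc S.
Variables (e a : nat -> X) (ha : S a) (haA : range a = rational_span sc e).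

Lemma scalars_archi (x : K) : 0 < x -> exists n : nat, x < n%:R.
Proof.
move=> x0; rewrite -(reK sc (ltW x0)); exists (Num.Def.truncn (re sc x)).+1.
rewrite -(of_real_nat sc) of_real_lt truncnS_gt//.
Qed.

Lemma norm_lt_dyadic (x : X) m k :
  (`|x| < 2 ^- m * k%:R) = (nrm sc x < 2 ^- m * k%:R).
Proof.
by rewrite -(of_real_nrm sc) -(of_real_expV sc) -(of_real_nat sc) -of_realM of_real_lt.
Qed.

Lemma nrm_beta_good c k m f : good a c k m f ->
  nrm sc (beta a (npair c k) - a (f m)) <= 2 ^- m * k%:R.
Proof.
move/(beta_good scalars_archi); rewrite -(of_real_nrm sc) -(of_real_expV sc).
by rewrite -(of_real_nat sc) -of_realM of_real_le.
Qed.

(* The sequence with code [j] is seen to follow the bounds far enough to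
   separate its limit from 0. *)
Definition nonzero_seen j := exists m y,
  [/\ computes (nfst j) m y, 2 ^- m * (nsnd j)%:R < nrm sc (a y) &
    forall l, (l < m)%N -> exists u u', [/\ computes (nfst j) l u,
      computes (nfst j) l.+1 u' &
      nrm sc (a u' - a u) < 2 ^- l.+1 * (nsnd j)%:R]].

Lemma sigma1_and3 P Q T : sigma1 P -> sigma1 Q -> sigma1 T ->
  sigma1 (fun x => [/\ P x, Q x & T x]).
Proof.
move=> hP hQ hT; apply: sigma1_ext (sigma1_and hP (sigma1_and hQ hT)) => x.
by split=> [[? []]|[]].
Qed.

Lemma sigma1_nonzero_seen : sigma1 nonzero_seen.
Proof.
apply: sigma1_ex; apply: sigma1_ex; apply: sigma1_and3.
- by apply: sigma1_computes; recur.
- apply: sigma1_ltr; first by apply: computable_real_dyadic; recur.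
  by apply: (computable_nrm hS); apply: (computable_reindex hS ha); recur.
apply: sigma1_bforall; first by recur.
apply: sigma1_ex; apply: sigma1_ex; apply: sigma1_and3.
- by apply: sigma1_computes; recur.
- by apply: sigma1_computes; recur.
apply: sigma1_ltr; last by apply: computable_real_dyadic; recur.
by apply: (computable_nrm hS); apply: (computable_sub hS ha ha); recur.
Qed.

Lemma beta_neq0 j : nonzero_seen j -> beta a j <> 0.
Proof.
move=> [m [y [cy ylt hl]]].
have /choice[f hf] : forall l, exists u, (l <= m)%N -> computes (nfst j) l u.
  move=> l; have [lm|] := ltnP l m.
    by have [u [_ [hu _ _]]] := hl _ lm; exists u.
  by move=> ml; exists y => lm; have -> : l = m by lia.
have gf : good a (nfst j) (nsnd j) m f.
  split=> // l lm; have [u [u' [hu hu']]] := hl l lm.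
  rewrite -norm_lt_dyadic (computes_fun hu (hf l _)) ?(ltnW lm)//.
  by rewrite (computes_fun hu' (hf _ lm)).
have := nrm_beta_good gf; rewrite npairK => h b0.
move: h; rewrite b0 sub0r nrmN (computes_fun (hf m (leqnn m)) cy).
by rewrite leNgt ylt.
Qed.

(** Once the radius is below half the norm of the limit, the current approximation has norm above
    that radius, which is the evidence sought. Never stopping guarantees that such a position is
    reached. *)
Lemma nonzero_seen_total j : beta a j <> 0 ->
  (forall m, exists f, good a (nfst j) (nsnd j) m f) -> nonzero_seen j.
Proof.
move=> /(nrm_gt0 sc) b0 tot.
have [m hm] : exists m : nat, 2 ^- m * (nsnd j)%:R < nrm sc (beta a j) / 2.
  have h0 : 0 < nrm sc (beta a j) / 2 by rewrite divr_gt0.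
  pose c := (Num.Def.truncn (nrm sc (beta a j) / 2)^-1).+1.
  by exists (c * nsnd j)%N; apply: dyadic_lt; rewrite ?truncnS_gt.
have [f gf] := tot m; exists m, (f m); split; first by apply: gf.1.
  have := nrm_beta_good gf; rewrite npairK => h.
  by have := ler_nrmD sc (beta a j - a (f m)) (a (f m)); rewrite subrK; lra.
move=> l lm; exists (f l), (f l.+1).
by split; [apply: gf.1; lia|exact: gf.1|rewrite -norm_lt_dyadic; exact: gf.2].
Qed.

(* Against an index [p] for F, take [phi_c(0) = v] and define [phi_c(1)] to be
   an index of 0 once the image [p <c, k>] is seen to be nonzero; [phi_c] is
   undefined elsewhere.  If this never happens then [F (a v)] is the limit of a
   sequence of A that does not stop, hence is seen to be nonzero; if it happens
   then the image is nonzero although [F 0 = 0]. *)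
Lemma not_quasi_effective_leaving_span (F : X -> X) v : F 0 = 0 ->
  ~ rational_span sc e (F (a v)) -> ~ quasi_effective a F.
Proof.
move=> F0 nA [p /choice[psi hpsi]].
have rpsi : recursive psi by exists p => i; exact: (hpsi i).1.
have [w aw] := span_index haA (rational_span0 sc e).
(* Large enough for the later jump from [a v] to 0 to satisfy the bound [2 ^- 1 * k] at position
   1. *)
pose k := (Num.Def.truncn (2 * nrm sc (a v))).+1.
have hk : 2 * nrm sc (a v) < k%:R.
  by rewrite truncnS_gt.
have [|c hc] := @sigma1_fixpoint (fun c x y =>
    (x == 0%N) && (y == v) \/
    (x == 1%N) && (y == w) /\ nonzero_seen (psi (npair c k))).
  apply: sigma1_or; first by apply: sigma1_dec; recur_if.
  apply: sigma1_and; first by apply: sigma1_dec; recur_if.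
  by apply: (sigma1_comp sigma1_nonzero_seen); recur.
pose j := psi (npair c k).
have Fj : F (beta a (npair c k)) = beta a j by exact: (hpsi _).2.
have c0 : computes c 0 v.
  have [h1 h2] := hc 0%N; have [|y hy] := h2; first by exists v; left; rewrite /= eqxx.
  by have [/= /eqP <-|[]] := h1 _ hy.
(* With no value at 2, a sequence that has jumped stops at position 1 and denotes 0. *)
have c2 y : ~ computes c 2 y by move/(hc 2%N).1; case=> // -[].
have [seen|unseen] := pselect (nonzero_seen j).
  apply: (beta_neq0 seen); rewrite -Fj.
  have c1 : computes c 1 w.
    have [h1 h2] := hc 1%N; have [|y hy] := h2; first by exists w; right; rewrite /= eqxx.
    by have [//|[/= /eqP <-]] := h1 _ hy.
  rewrite (@beta_stuck _ _ _ _ _ 1 (fun l => if l == 0%N then v else w)) ?aw//.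
    split; first by case=> [|[|l]].
    case=> // _; rewrite norm_lt_dyadic /= aw sub0r nrmN.
    by rewrite expr1 mulrC ltr_pdivlMr// mulrC.
  by case=> f [/(_ 2%N (leqnn _)) /c2].
apply: (unseen); have bj : beta a j = F (a v).
  rewrite -Fj (@beta_stuck _ _ _ _ _ 0 (fun=> v))//.
    by split=> // l; rewrite leqn0 => /eqP->.
  case=> f [/(_ 1%N (leqnn _)) /(hc 1%N).1 [//|[_ seen]] _].
  exact: unseen.
apply: nonzero_seen_total.
  by rewrite bj => Fv; apply: nA; rewrite Fv; exact: rational_span0.
by apply: beta_total; rewrite npairK bj haA.
Qed.

(* The image of [a 0] differs from [a 0], so its code has a value [u] at 0; this
   confines the limit to a ball around [a u], and [phi_c(0)] can then be chosen
   so that the image escapes from this ball. *)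
Lemma not_quasi_effective_sqrt2 : a 0%N <> 0 ->
  ~ quasi_effective a (fun x => of_real sc (Num.sqrt 2) *: x).
Proof.
move=> a0 [p /choice[psi hpsi]].
have rpsi : recursive psi by exists p => i; exact: (hpsi i).1.
have s1 : 1 < Num.sqrt 2 :> R.
  by rewrite -[X in X < _]sqrtr1 ltr_sqrt// ltr1n.
(* The bound 0 in [npair c 0] is harmless, as only position 0 gets a value. The image lies within
   its own bound of [a u], so its norm is at most [M] plus that bound; [a y] is required to be
   larger already before scaling. The factors [2 ^- 0] only match the form of computable dyadic
   sequences. *)
have [|c hc] := @sigma1_fixpoint (fun c x y => x == 0%N /\ exists u M,
    [/\ computes (nfst (psi (npair c 0))) 0 u, nrm sc (a u) < 2 ^- 0 * M%:R &
     2 ^- 0 * (M + nsnd (psi (npair c 0)))%:R < nrm sc (a y)]).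
  apply: sigma1_and; first by apply: sigma1_dec; recur.
  apply: sigma1_ex; apply: sigma1_ex; apply: sigma1_and3.
  - by apply: sigma1_computes; recur.
  - apply: sigma1_ltr; last by apply: computable_real_dyadic; recur.
    by apply: (computable_nrm hS); apply: (computable_reindex hS ha); recur.
  - apply: sigma1_ltr; first by apply: computable_real_dyadic; recur.
    by apply: (computable_nrm hS); apply: (computable_reindex hS ha); recur.
have [_ Fj] := hpsi (npair c 0).
move: (psi _) Fj hc => j Fj hc.
have c1 y : ~ computes c 1 y by move/(hc 1%N).1; case.
have [[y cy]|ndef] := pselect (exists y, computes c 0 y).
  have [_ [u [M [cu uM My]]]] := (hc 0%N).1 _ cy.
  rewrite (@beta_stuck _ _ _ _ _ 0 (fun=> y)) in Fj.
  - have gj : good a (nfst j) (nsnd j) 0 (fun=> u).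
      by split=> // l; rewrite leqn0 => /eqP->.
    have := nrm_beta_good gj; rewrite npairK -Fj => h.
    have := ler_nrmD sc (of_real sc (Num.sqrt 2) *: a y - a u) (a u).
    rewrite subrK nrmZ ger0_norm ?sqrtr_ge0//.
    have : nrm sc (a y) <= Num.sqrt 2 * nrm sc (a y).
      by rewrite ler_peMl ?nrm_ge0// ltW.
    by move: My; rewrite natrD; lra.
  - by split=> // l; rewrite leqn0 => /eqP->.
  - by case=> f [/(_ 1%N (leqnn _)) /c1].
apply: (ndef); apply: (hc 0%N).2.
(* If neither program had a value at 0, both indices would denote [a 0], which would then be fixed
   by the scaling and hence be 0. *)
have [u cu] : exists u, computes (nfst j) 0 u.
  apply: contrapT => nu; move: Fj; rewrite beta_undef; last first.
    by move=> y cy; apply: ndef; exists y.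
  rewrite -[j]npairK beta_undef; last by move=> u cu; apply: nu; exists u.
  move=> /eqP; rewrite -subr_eq0 -[X in _ - X]scale1r -(of_real1 sc) of_realBZ.
  rewrite scaler_eq0 => /orP[/eqP|/eqP //].
  by rewrite -(of_real0 sc) => /(congr1 (re sc)); rewrite !of_realK; lra.
pose M := (Num.Def.truncn (nrm sc (a u))).+1.
have [y hy] := span_unbounded haA (M + nsnd j)%:R (in_span haA 0) a0.
exists y; split=> //; exists u, M; rewrite expr0 invr1 !mul1r; split=> //.
by rewrite truncnS_gt.
Qed.

End NotQuasiEffective.

Theorem theorem28 (R : realType) (K : numFieldType) (sc : scalars R K)
    (X : completeNormedModType K)
    (S : set (nat -> X)) (hS : computability_structure sc S)
    (e : nat -> X) (he : S e) (hdense : dense (linear_span e))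
    (a : nat -> X) (ha : S a) (haA : range a = rational_span sc e)
    (hX : exists x : X, x <> 0) :
  let sqrt2 := fun x : X => of_real sc (Num.sqrt 2) *: x in
  [/\ exists F : X -> X,
        [/\ bounded_linear F,
            F @` computable_elements S `<=` computable_elements S &
            ~ quasi_effective a F],
      bounded_linear sqrt2,
      effective a sqrt2 &
      (a 0%N <> 0 \/
       exists2 x, rational_span sc e x & ~ rational_span sc e (sqrt2 x)) ->
      ~ quasi_effective a sqrt2].
Proof.
move=> sqrt2; split.
- have [v v0] : exists v, a v <> 0.
    (* Each [e i] belongs to A, so if A were trivial the linear span would be 0 and would miss the
       nonempty open set of nonzero vectors, against density. *)
    apply: contrapT => /forallNP av0.
    have e0 i : e i = 0.
      have [|v <-] := @span_index _ _ _ _ _ _ haA (e i).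
        exists i.+1, (fun k => of_real sc (k == i)%:R); split.
          by move=> k; have := rational_of_real sc (k == i)%:R; rewrite ratr_nat.
        rewrite big_ord_recr /= eqxx of_real1 scale1r big1 ?add0r// => k _.
        by rewrite ltn_eqF// of_real0 scale0r.
      by apply: contrapT; exact: av0.
    have [x x0] := hX.
    have [||y [/= y0 [N [c yE]]]] := hdense (~` [set 0]).
    + by exists x.
    + apply: closed_openC; apply: accessible_closed_set1.
      exact/hausdorff_accessible/norm_hausdorff.
    apply: y0; by rewrite yE big1// => i _; rewrite e0 scaler0.
  have [c hc cv] := scale_avoiding hS ha v0.
  exists (fun x => of_real sc c *: x); split.
  + exact: bounded_linear_scale.
  + exact: (computable_elements_scale hS).
  + apply: (not_quasi_effective_leaving_span hS ha haA (v := v)).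
      by rewrite scaler0.
    by move=> /(span_index haA) [n /esym /cv].
- exact: bounded_linear_scale.
- exact: (effective_scale_sqrt2 hS ha haA).
- case=> [a0|[x Ax nAx]]; first exact: (not_quasi_effective_sqrt2 hS ha haA a0).
  have [v av] := span_index haA Ax.
  apply: (not_quasi_effective_leaving_span hS ha haA (v := v)).
    by rewrite /sqrt2 scaler0.
  by rewrite av.
Qed.
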